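(* Let $\pi_1,\pi_2,\pi_3:\mathbb R^2\to\mathbb R$ be pairwise linearly independent linear maps, and for each $j$ let $v_j\in\mathbb R^2$ be a unit vector with $\pi_j(v_j)=0$. Put $D_{\boldsymbol\pi^\perp}=\prod_{j=1}^3 (v_j\cdot\nabla)$. Let $a\in C_c^\infty(\mathbb R^2)$ be supported in a (bounded) neighborhood of $0$, and let $S$ be a real-valued smooth function on a neighborhood of $\mathrm{Conv}(\mathrm{supp}(a))$ (the convex hull of the support of $a$) such that $$|D_{\boldsymbol\pi^\perp}S(x,y)|\ge 1\quad\text{for all }(x,y)\in\mathrm{Conv}(\mathrm{supp}(a)).$$ For $\lambda\in\mathbb R\setminus\{0\}$ and $f_1,f_2,f_3\in L^2(\mathbb R)$ define $$\Lambda_{S,\boldsymbol\pi}(f_1,f_2,f_3)=\iint e^{i\lambda S(x,y)}a(x,y)\prod_{j=1}^3 f_j(\pi_j(x,y))\,dx\,dy.$$ Then there is a constant $C$ (depending on $a,S,\boldsymbol\pi$ but not on $\lambda$ or the $f_j$) such that $$|\Lambda_{S,\boldsymbol\pi}(f_1,f_2,f_3)|\le C|\lambda|^{-1/6}\prod_{j=1}^3\|f_j\|_{L^2(\mathbb R)}.$$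
   Context: $\mathrm{Conv}(X)$ denotes the convex hull of $X\subset\mathbb R^2$. The operator $v\cdot\nabla$ is the directional derivative in direction $v$. *)

(* Defs.v *)
From HB Require Import structures.
From mathcomp Require Import all_boot all_order all_algebra.
From mathcomp Require Import all_classical all_reals all_analysis.
From mathcomp Require Import complex.
Set Implicit Arguments. Unset Strict Implicit. Unset Printing Implicit Defensive.
Import Order.TTheory GRing.Theory Num.Theory.
Import numFieldNormedType.Exports.
Local Open Scope classical_set_scope.
Local Open Scope ring_scope.

Section Defs.
Variable R : realType.

(* The plane R^2 is modelled as R * R (a normed module over R, used only
   for directional derivatives; Euclidean notions are written out). *)
Definition pt := (R * R)%type.

Definition iterDir (ds : seq pt) (f : pt -> R) : pt -> R :=
  foldr (fun v g => 'D_v g) f ds.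

Definition smooth_on (U : set pt) (f : pt -> R) :=
  open U /\
  forall (ds : seq pt) (x : pt), U x ->
    {for x, continuous (iterDir ds f)} /\ forall v : pt, derivable (iterDir ds f) x v.

Definition supp (a : pt -> R[i]) : set pt := closure [set x | a x != 0].

Definition Cc_infty (a : pt -> R[i]) :=
  smooth_on setT (fun x => complex.Re (a x)) /\
  smooth_on setT (fun x => complex.Im (a x)) /\
  compact (supp a).

Definition convex2 (C : set pt) :=
  forall (p q : pt) (t : R), 0 <= t <= 1 -> C p -> C q ->
    C ((1 - t) * p.1 + t * q.1, (1 - t) * p.2 + t * q.2).

Definition Conv (A : set pt) : set pt :=
  [set z | forall C, convex2 C -> A `<=` C -> C z].

Definition linmap (c : pt) (p : pt) : R := c.1 * p.1 + c.2 * p.2.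

Definition cabs (z : R[i]) : R :=
  Num.sqrt (complex.Re z ^+ 2 + complex.Im z ^+ 2).

Definition cis (t : R) : R[i] := (cos t +i* sin t)%C.

Definition leb := (@lebesgue_measure R).

Definition L2 (f : R -> R[i]) :=
  measurable_fun setT (fun t => complex.Re (f t)) /\
  measurable_fun setT (fun t => complex.Im (f t)) /\
  (\int[leb]_(t in setT) ((cabs (f t)) ^+ 2)%:E < +oo)%E.

Definition L2norm (f : R -> R[i]) : R :=
  Num.sqrt (fine (\int[leb]_(t in setT) ((cabs (f t)) ^+ 2)%:E)%E).

Definition leb2 := (leb \x leb)%E.

Definition cintegral2 (F : pt -> R[i]) : R[i] :=
  ((\int[leb2]_(p in setT) complex.Re (F p)) +i*
   (\int[leb2]_(p in setT) complex.Im (F p)))%C.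

Definition Lambda (lam : R) (S : pt -> R) (a : pt -> R[i])
    (pi : 'I_3 -> pt) (f : 'I_3 -> R -> R[i]) : R[i] :=
  cintegral2 (fun p => cis (lam * S p) * a p * \prod_(j < 3) f j (linmap (pi j) p)).

End Defs.

(* Main.v *)
(* Write points as p = x w0 + y w1 with w0, w1 multiples of v_1, v_2 normalised by pi_3; then the
   three linear forms become multiples of y, x and x + y, and w0 - w1 is a multiple of v_3. Two
   applications of Cauchy-Schwarz (the TT* argument in y with shift h in x, then in x with shift k
   along x + y = const) leave the oscillatory integral over lines parallel to v_3 with phase
   lambda * Delta_h Delta_k S, where Delta_h and Delta_k are differences along w0 and w1. By the
   mean value theorem for mixed differences its derivative is lambda h k D S at a point of
   Conv(supp a), up to constants, so integrating by parts twice bounds this integral by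
   A / (1 + (lambda h k)^2) with no monotonicity assumption. Integrating in k, and treating
   |h| <= |lambda|^(-1/3) trivially, gives the decay |lambda|^(-1/3) for the square of the form.
   General L^2 functions follow by truncation, complex-valued data by splitting into real and
   imaginary parts. *)
Require Import Defs.
From HB Require Import structures.
From mathcomp Require Import all_boot all_order all_algebra.
From mathcomp Require Import all_classical all_reals all_analysis.
From mathcomp Require Import complex.
From mathcomp Require Import measurable_realfun ring lra.
Import Order.TTheory GRing.Theory Num.Theory.
Import numFieldNormedType.Exports.
Local Open Scope classical_set_scope.
Local Open Scope ring_scope.
Set Implicit Arguments. Unset Strict Implicit. Unset Printing Implicit Defensive.

(** * Integration on the line and the plane *)

Section Integration.
Context {R : realType}.
Local Notation mu := (@lebesgue_measure R).

(** The exponent comes from a balance: shifts |h| <= delta contribute O(delta), while beyond delta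
    the pointwise gain is (|lambda| delta)^(-1/2), and the remaining factors are integrable in h;
    the two agree at delta = |lambda|^(-1/3). One integration by parts would give only 1/|lambda h
    k|, whose integral in k diverges logarithmically, hence two. They lose nothing as h or k tends
    to 0: each derivative of the phase along v_3 is again a mixed difference, so it carries the same
    factor h k as the lower bound on the first derivative, and the ratios stay bounded. Convexity
    enters because the mean value theorem lands in the parallelogram spanned by four points of the
    support. Elsewhere [S] is arbitrary, so the phase is controlled only where the amplitude does
    not vanish identically nearby. All exchanges of integrals are made within bounded compactly
    supported functions. *)

Lemma open_measurable2 (A : set (R * R)) : open A -> measurable A.
Proof.
move=> oA.
pose B (q : rat * rat * rat) : set (R * R) :=
  ball (ratr q.1.1 : R) (ratr q.2) `*` ball (ratr q.1.2 : R) (ratr q.2).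
(* Rational squares contained in [A]; squares that are not contained count as empty, which keeps the
   countable index set independent of [A]. *)
have -> : A = \bigcup_q (if pselect (B q `<=` A) then B q else set0).
  apply/seteqP; split => [[x y] Axy|p [q _]]; last first.
    by case: pselect => // qA /qA.
  have [e /= e0 eA] : exists2 e : R, 0 < e & ball (x, y) e `<=` A.
    by move: oA => /(_ _ Axy) /nbhs_ballP[e e0 eA]; exists e.
  (* A centre within e/4 and a radius between e/4 and e/2: the square then contains the point and
     stays inside the ball of radius e. *)
  have /rat_in_itvoo[r] : e / 4 < e / 2 by lra.
  rewrite in_itv/= => /andP[r1 r2].
  have /rat_in_itvoo[q1] : x - e / 4 < x + e / 4 by lra.
  rewrite in_itv/= => /andP[q11 q12].
  have /rat_in_itvoo[q2] : y - e / 4 < y + e / 4 by lra.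
  rewrite in_itv/= => /andP[q21 q22].
  have BA : B (q1, q2, r) `<=` A.
    case=> u v [] /=; rewrite -!ball_normE /= !ltr_norml => /andP[u1 u2].
    move=> /andP[v1 v2]; apply: eA; split; rewrite /= -ball_normE /= ltr_norml;
      by apply/andP; split; lra.
  exists (q1, q2, r) => //; case: (pselect _) => // ?.
  by split; rewrite /= -ball_normE /= ltr_norml; apply/andP; split; lra.
apply: countable_bigcupT_measurable; first exact: countableP.
move=> q; case: (pselect _) => ?; last exact: measurable0.
by apply: measurableX; exact: measurable_ball.
Qed.

Lemma continuous2_measurable (f : R * R -> R) :
  continuous f -> measurable_fun setT f.
Proof.
move=> /continuousP cf; apply: (measurability _ (RGenOpens.measurableE R)).
by move=> _ [_ [a [b ->] <-]]; rewrite setTI; apply: open_measurable2; apply: cf; exact: interval_open.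
Qed.

(** By uniqueness of Lebesgue measure it suffices to test half-open intervals. A negative slope
    turns the preimage into an interval closed on the left instead of the right, hence the two
    cases. *)
Lemma lebesgue_measure_affine (a b : R) (A : set R) : a != 0 -> measurable A ->
  mu A = (`|a|%:E * mu [set x | A (a * x + b)%R])%E.
Proof.
move=> a0 mA.
have mphi : measurable_fun [set: measurableTypeR R]
    ((fun x => a * x + b) : measurableTypeR R -> measurableTypeR R).
  by apply: continuous_measurable_fun => x; apply: cvgD; [exact: cvgMr|exact: cvg_cst].
pose p := pushforward mu ((fun x => a * x + b) : measurableTypeR R -> measurableTypeR R).
have h := @lebesgue_measure_unique R (mscale (NngNum (normr_ge0 a)) p).
rewrite h //= => _ [[u v] _ <-].
rewrite /mscale/= /pushforward /= lebesgue_measure_itv/= lte_fin.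
have [a_gt0|a_lt0|a_eq0] := ltgtP a 0; last by rewrite a_eq0 eqxx in a0.
- have -> : (fun x : measurableTypeR R => (a * x + b)%R) @^-1` `]u, v] =
      `[(v - b) / a, (u - b) / a[%classic.
    apply/seteqP; split => x /=; rewrite !in_itv/= => /andP[h1 h2];
      apply/andP; split.
    + by rewrite ler_ndivrMr//; nra.
    + by rewrite ltr_ndivlMr//; nra.
    + by move: h2; rewrite ltr_ndivlMr//; nra.
    + by move: h1; rewrite ler_ndivrMr//; nra.
  rewrite lebesgue_measure_itv/= lte_fin ltr_nM2r ?invr_lt0// ltrBlDr subrK.
  case: ifPn => _; last by rewrite mule0.
  by rewrite -!EFinD -EFinM ltr0_norm//; congr EFin; field.
- have -> : (fun x : measurableTypeR R => (a * x + b)%R) @^-1` `]u, v] =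
      `](u - b) / a, (v - b) / a]%classic.
    apply/seteqP; split => x /=; rewrite !in_itv/= => /andP[h1 h2];
      apply/andP; split.
    + by rewrite ltr_pdivrMr//; nra.
    + by rewrite ler_pdivlMr//; nra.
    + by move: h1; rewrite ltr_pdivrMr//; nra.
    + by move: h2; rewrite ler_pdivlMr//; nra.
  rewrite lebesgue_measure_itv/= lte_fin ltr_pM2r ?invr_gt0// ltrBlDr subrK.
  case: ifPn => _; last by rewrite mule0.
  by rewrite -!EFinD -EFinM gtr0_norm//; congr EFin; field.
Qed.

Lemma measurable_affine (a b : R) : measurable_fun setT (fun x : R => a * x + b).
Proof.
by apply: continuous_measurable_fun => x; apply: cvgD; [exact: cvgMr|exact: cvg_cst].
Qed.

Lemma ge0_integral_affine (a b : R) (f : R -> \bar R) : a != 0 ->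
  measurable_fun setT f -> (forall x, 0 <= f x)%E ->
  (\int[mu]_x f x = `|a|%:E * \int[mu]_x f (a * x + b)%R)%E.
Proof.
move=> a0 mf f0.
pose phi := (fun x => a * x + b) : measurableTypeR R -> measurableTypeR R.
have mphi : measurable_fun setT phi := measurable_affine a b.
rewrite -(ge0_integral_pushforward mphi mu measurableT mf); last by move=> x _; exact: f0.
have := @ge0_integral_mscale _ _ R (pushforward mu phi) _ measurableT (NngNum (normr_ge0 a)) f.
move=> <-//.
apply: eq_measure_integral => A mA _; rewrite /mscale/=.
exact: lebesgue_measure_affine.
Qed.

Lemma integral_shift (c : R) (f : R -> \bar R) : measurable_fun setT f ->
  (\int[mu]_x f x = \int[mu]_x f (x + c)%R)%E.
Proof.
move=> mf; rewrite integralE [RHS]integralE.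
have e (g : R -> \bar R) : measurable_fun setT g -> (forall x, 0 <= g x)%E ->
    (\int[mu]_x g x = \int[mu]_x g (x + c)%R)%E.
  move=> mg g0; rewrite (ge0_integral_affine c (oner_neq0 R) mg g0) normr1 mul1e.
  by apply: eq_integral => x _; rewrite mul1r.
have ep := e (funepos f) (measurable_funepos mf) (fun x => funepos_ge0 f x).
have en := e (funeneg f) (measurable_funeneg mf) (fun x => funeneg_ge0 f x).
rewrite ep en; congr (_ - _)%E; apply: eq_integral => x _.
  by rewrite !funeposE.
by rewrite !funenegE.
Qed.

Lemma Rintegral_shift (c : R) (f : R -> R) : measurable_fun setT f ->
  \int[mu]_x f x = \int[mu]_x f (x + c).
Proof.
by move=> mf; rewrite /Rintegral (integral_shift c)//; exact/measurable_EFinP.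
Qed.

Lemma measurable_Rintegral d (T : measurableType d) (F : T * R -> R) :
  measurable_fun setT F -> measurable_fun setT (fun x => \int[mu]_t F (x, t)).
Proof.
move=> mF; have mE : measurable_fun setT (EFin \o F) by exact/measurable_EFinP.
apply: measurableT_comp; first exact: fine_measurable.
under eq_fun do rewrite integralE.
apply: emeasurable_funB.
  have h := measurable_fun_fubini_tonelli_F (m2 := mu) (funepos (EFin \o F))
    (measurable_funepos mE) (fun x => funepos_ge0 _ x).
  apply: eq_measurable_fun h => x _; apply: eq_integral => t _.
  by rewrite !funeposE.
have h := measurable_fun_fubini_tonelli_F (m2 := mu) (funeneg (EFin \o F))
    (measurable_funeneg mE) (fun x => funeneg_ge0 _ x).
apply: eq_measurable_fun h => x _; apply: eq_integral => t _.
by rewrite !funenegE.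
Qed.

Lemma lebesgue_measure_symitv (M : R) : 0 <= M ->
  mu `[- M, M]%classic = (2 * M)%:E.
Proof.
move=> M0; rewrite lebesgue_measure_itv/= lte_fin; case: ifPn => [_|].
  by rewrite -EFinD; congr EFin; lra.
by move=> h; congr EFin; move: h; rewrite -leNgt => h; lra.
Qed.

(* [N] plays the role of a norm on [T]: [bcs N F] says that [F] is bounded, measurable and vanishes outside a ball. *)
Definition bcs d (T : measurableType d) (N : T -> R) (F : T -> R) :=
  measurable_fun setT F /\
  exists M, forall x, `|F x| <= M /\ (M < N x -> F x = 0).

Lemma bcsP d (T : measurableType d) (N F : T -> R) (A B : R) :
  measurable_fun setT F -> (forall x, `|F x| <= A) ->
  (forall x, B < N x -> F x = 0) -> bcs N F.
Proof.
move=> mF hA hB; split => //; exists (Num.max A B) => x; split.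
  by rewrite le_max hA.
by rewrite gt_max => /andP[_]; exact: hB.
Qed.

Lemma bcsE d (T : measurableType d) (N F : T -> R) : bcs N F ->
  exists2 M : R, 0 <= M & forall x, `|F x| <= M /\ (M < N x -> F x = 0).
Proof.
move=> [_ [M h]]; exists `|M| => // x; have [h1 h2] := h x; split.
  by rewrite (le_trans h1)// ler_norm.
by move=> /(le_lt_trans (ler_norm M)).
Qed.

Lemma bcs_mull d (T : measurableType d) (N F G : T -> R) (A : R) : bcs N F ->
  measurable_fun setT G -> (forall x, `|G x| <= A) -> bcs N (fun x => G x * F x).
Proof.
move=> bF mG hA; have [M M0 h] := bcsE bF; case: bF => mF _.
apply: (@bcsP _ _ _ _ (A * M) M); first exact: measurable_funM.
  by move=> x; rewrite normrM ler_pM//; exact: (h x).1.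
by move=> x /(h x).2 ->; rewrite mulr0.
Qed.

Lemma bcsM d (T : measurableType d) (N F G : T -> R) : bcs N F -> bcs N G ->
  bcs N (fun x => F x * G x).
Proof.
move=> bF bG; have [M M0 h] := bcsE bF.
by apply: (bcs_mull bG); [exact: bF.1|move=> x; exact: (h x).1].
Qed.

Lemma bcsD d (T : measurableType d) (N F G : T -> R) : bcs N F -> bcs N G ->
  bcs N (fun x => F x + G x).
Proof.
move=> bF bG; have [M M0 h] := bcsE bF; have [M' M'0 h'] := bcsE bG.
apply: (@bcsP _ _ _ _ (M + M') (Num.max M M')).
- by apply: measurable_funD; [exact: bF.1|exact: bG.1].
- by move=> x; rewrite (le_trans (ler_normD _ _))// lerD//; [exact: (h x).1|exact: (h' x).1].
- by move=> x; rewrite gt_max => /andP[/(h x).2 -> /(h' x).2 ->]; rewrite addr0.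
Qed.

Lemma bcs_norm d (T : measurableType d) (N F : T -> R) : bcs N F ->
  bcs N (fun x => `|F x|).
Proof.
move=> bF; have [M M0 h] := bcsE bF; apply: (@bcsP _ _ _ _ M M).
- by apply: measurableT_comp => //; exact: bF.1.
- by move=> x; rewrite normr_id; exact: (h x).1.
- by move=> x /(h x).2 ->; rewrite normr0.
Qed.

Lemma bcsZ d (T : measurableType d) (N F : T -> R) (c : R) : bcs N F ->
  bcs N (fun x => c * F x).
Proof. by move=> bF; apply: (@bcs_mull _ _ _ _ _ `|c| bF). Qed.

Local Notation bcs1 := (bcs (@Num.norm R R)).
Local Notation bcs2 := (bcs (fun p : R * R => Num.max `|p.1| `|p.2|)).

Lemma bcs_integrable (f : R -> R) : bcs1 f -> mu.-integrable setT (EFin \o f).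
Proof.
move=> bf; have [M M0 h] := bcsE bf.
have -> : f = f \_ `[- M, M].
  apply/funext => x; rewrite /patch; case: ifPn => // /negP hx.
  apply: (h x).2; rewrite ltNge; apply/negP => hM; apply: hx.
  by rewrite inE/= in_itv/= -ler_norml.
rewrite -restrict_EFin; apply/integrable_restrict => //=; rewrite setTI.
apply: measurable_bounded_integrable => //.
- by rewrite [X in (X < _)%E](lebesgue_measure_symitv M0) ltry.
- by apply: measurable_funTS; exact: bf.1.
- by exists M; split; [exact: num_real|move=> N MN x _; apply: le_trans (h x).1 _; exact: ltW].
Qed.

Lemma Rintegral_le_box (f : R -> R) (A M : R) : bcs1 f -> 0 <= M ->
  (forall x, `|f x| <= A) -> (forall x, M < `|x| -> f x = 0) ->
  `|\int[mu]_x f x| <= 2 * M * A.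
Proof.
move=> bf M0 hA hM.
have -> : f = f \_ `[- M, M].
  apply/funext => x; rewrite /patch; case: ifPn => // /negP hx.
  apply: hM; rewrite ltNge; apply/negP => hM'; apply: hx.
  by rewrite inE/= in_itv/= -ler_norml.
rewrite -Rintegral_mkcond.
have if_ : mu.-integrable `[- M, M] (EFin \o f).
  by apply: integrableS (bcs_integrable bf).
rewrite (le_trans (le_normr_Rintegral _ if_))//.
have lM := lebesgue_measure_symitv M0.
have -> : 2 * M * A = \int[mu]_(x in `[- M, M]) A by rewrite Rintegral_cst//= lM/= mulrC.
apply: le_Rintegral => //.
  by have := integrable_norm if_.
apply: measurable_bounded_integrable => //; first by rewrite [X in (X < _)%E]lM ltry.
by exists `|A|; split; [exact: num_real|move=> N AN x _; exact: ltW].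
Qed.

Lemma bcs_section d (T : measurableType d) (N : T -> R) (F : T * R -> R) (x : T) :
  bcs (fun p : T * R => Num.max (N p.1) `|p.2|) F -> bcs1 (fun t => F (x, t)).
Proof.
move=> bF; have [M M0 h] := bcsE bF; apply: (@bcsP _ _ _ _ M M).
- by apply: measurableT_comp; [exact: bF.1|exact: pair1_measurable].
- by move=> t; exact: (h _).1.
- by move=> t Mt; apply: (h _).2; rewrite /= lt_max Mt orbT.
Qed.

Lemma bcs_Rintegral d (T : measurableType d) (N : T -> R) (F : T * R -> R) :
  bcs (fun p : T * R => Num.max (N p.1) `|p.2|) F -> bcs N (fun x => \int[mu]_t F (x, t)).
Proof.
move=> bF; have [M M0 h] := bcsE bF; apply: (@bcsP _ _ _ _ (2 * M * M) M).
- by apply: measurable_Rintegral; exact: bF.1.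
- move=> x; apply: Rintegral_le_box => //; first exact: bcs_section bF.
    by move=> t; exact: (h _).1.
  by move=> t Mt; apply: (h _).2; rewrite /= lt_max Mt orbT.
- move=> x Mx; rewrite (_ : (fun t => F (x, t)) = cst 0).
    by rewrite /Rintegral integral0.
  by apply/funext => t; apply: (h _).2; rewrite /= lt_max Mx.
Qed.

Lemma bcs2_swap (F : R * R -> R) : bcs2 F -> bcs2 (fun p => F (p.2, p.1)).
Proof.
move=> bF; have [M M0 h] := bcsE bF; apply: (@bcsP _ _ _ _ M M).
- by apply: measurableT_comp; [exact: bF.1|exact: measurable_swap].
- by move=> t; exact: (h _).1.
- by move=> t Mt; apply: (h _).2; rewrite /= maxC.
Qed.

Lemma bcs2_section1 (F : R * R -> R) (y : R) : bcs2 F -> bcs1 (fun x => F (x, y)).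
Proof. by move=> /bcs2_swap bF; exact: (bcs_section y bF). Qed.

Lemma bcs2_Rintegral1 (F : R * R -> R) : bcs2 F -> bcs1 (fun y => \int[mu]_x F (x, y)).
Proof. by move=> /bcs2_swap/bcs_Rintegral. Qed.

(** Sections and partial integrals stay in the class [bcs], so the iterated integral of the norm is
    finite and Tonelli applies. *)
Lemma bcs2_integrable (F : R * R -> R) : bcs2 F ->
  (mu \x mu)%E.-integrable setT (EFin \o F).
Proof.
move=> bF; apply/integrable12ltyP; first by apply/measurable_EFinP; exact: bF.1.
have h := integrable_fin_num measurableT (bcs_integrable (bcs_Rintegral (bcs_norm bF))).
rewrite [X in (X < _)%E](_ : _ = \int[mu]_x (\int[mu]_t `|F (x, t)|)%:E)%E.
  by rewrite ltey_eq h.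
apply: eq_integral => x _.
rewrite /Rintegral fineK//.
exact: (integrable_fin_num measurableT (bcs_integrable (bcs_section x (bcs_norm bF)))).
Qed.

Lemma Rintegral_bcs2 (F : R * R -> R) : bcs2 F ->
  \int[(mu \x mu)%E]_p F p = \int[mu]_x \int[mu]_y F (x, y).
Proof.
move=> bF; rewrite {1}/Rintegral -(integral12_prod_meas1 (bcs2_integrable bF)).
congr fine; apply: eq_integral => x _; rewrite /fubini_F /Rintegral fineK//.
exact: (integrable_fin_num measurableT (bcs_integrable (bcs_section x bF))).
Qed.

Lemma Rintegral_bcs2_swap (F : R * R -> R) : bcs2 F ->
  \int[mu]_x \int[mu]_y F (x, y) = \int[mu]_y \int[mu]_x F (x, y).
Proof.
move=> bF; rewrite -Rintegral_bcs2// {1}/Rintegral -(integral21_prod_meas1 (bcs2_integrable bF)).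
congr fine; apply: eq_integral => x _; rewrite /fubini_G /Rintegral fineK//.
exact: (integrable_fin_num measurableT (bcs_integrable (bcs2_section1 x bF))).
Qed.

(** The quadratic polynomial in s given by the integral of (f - s g)^2 is nonnegative; evaluate it
    at its minimum s = b / c. *)
Lemma bcs_cauchy_schwarz (f g : R -> R) : bcs1 f -> bcs1 g ->
  (\int[mu]_x (f x * g x)) ^+ 2 <= \int[mu]_x (f x ^+ 2) * \int[mu]_x (g x ^+ 2).
Proof.
move=> bf bg.
set a := \int[mu]_x (f x ^+ 2); set b := \int[mu]_x (f x * g x); set c := \int[mu]_x (g x ^+ 2).
have h s : 0 <= a - 2 * s * b + s ^+ 2 * c.
  have -> : a - 2 * s * b + s ^+ 2 * c = \int[mu]_x ((f x - s * g x) ^+ 2).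
    have bff : bcs1 (fun x => f x ^+ 2) := bcsM bf bf.
    have bgg : bcs1 (fun x => g x ^+ 2) := bcsM bg bg.
    have bfg : bcs1 (fun x => - (2 * s) * (f x * g x)) := bcsZ _ (bcsM bf bg).
    rewrite /a /b /c -mulNr -!RintegralZl ?(bcs_integrable bgg) ?(bcs_integrable (bcsM bf bg))//.
    rewrite -RintegralD ?(bcs_integrable bff) ?(bcs_integrable bfg)//.
    rewrite -RintegralD ?(bcs_integrable (bcsD bff bfg)) ?(bcs_integrable (bcsZ _ bgg))//.
    by apply: eq_Rintegral => x _; ring.
  by apply: Rintegral_ge0 => x _; exact: sqr_ge0.
have c0 : 0 <= c by apply: Rintegral_ge0 => x _; exact: sqr_ge0.
have [c_eq0|cn0] := eqVneq c 0.
  have hb : b = 0.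
    apply/eqP/negPn/negP => bn0.
    (* For c = 0 the polynomial is affine in s, and this s gives it the value -1. *)
    have := h ((a + 1) / (2 * b)); rewrite c_eq0 mulr0 addr0.
    have -> : 2 * ((a + 1) / (2 * b)) * b = a + 1 by field.
    by lra.
  by rewrite hb c_eq0 mulr0 expr0n.
have := h (b / c).
have -> : a - 2 * (b / c) * b + (b / c) ^+ 2 * c = (a * c - b ^+ 2) / c by field.
by rewrite pmulr_lge0 ?invr_gt0 ?lt_def ?cn0//; lra.
Qed.

End Integration.

(** * The TT* argument *)

Ltac mfun_atom := first [ assumption
  | match goal with H : bcs _ ?g |- measurable_fun _ ?g => exact: H.1 end
  | exact: normr_measurable | exact: measurable_fst | exact: measurable_snd ].
Ltac mfun := first [exact: measurable_cst | lazymatch goal with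
 | |- measurable_fun _ (fun x => x) => exact: measurable_id
 | |- measurable_fun _ (fun x => @GRing.add _ (@?a x) (@?b x)) =>
     apply: (@measurable_funD _ _ _ _ a b); mfun
 | |- measurable_fun _ (fun x => @GRing.mul _ (@?a x) (@?b x)) =>
     apply: (@measurable_funM _ _ _ _ a b); mfun
 | |- measurable_fun _ (fun x => @GRing.opp _ (@?a x)) =>
     apply: (@measurable_funN _ _ _ _ a); mfun
 | |- measurable_fun _ (fun x => @GRing.exp _ (@?a x) ?n) =>
     apply: (@measurable_funX _ _ _ _ a n); mfun
 | |- measurable_fun _ (fun x => (@?a x, @?b x)) =>
     apply: (@measurable_fun_pair _ _ _ _ _ _ a b); mfun
 | |- measurable_fun _ (fun x => fst x) => exact: measurable_fst
 | |- measurable_fun _ (fun x => snd x) => exact: measurable_snd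
 | |- measurable_fun _ (fun x => ?g (@?a x)) =>
     first [mfun_atom | apply: (@measurableT_comp _ _ _ _ _ _ g setT a); [mfun_atom | mfun]]
 | |- _ => mfun_atom
 end].

Section TTstar.
Context {R : realType}.
Local Notation mu := (@lebesgue_measure R).
Local Notation bcs1 := (bcs (@Num.norm R R)).
Local Notation bcs2 := (bcs (fun p : R * R => Num.max `|p.1| `|p.2|)).

Lemma bcs_shift (f : R -> R) (c : R) : bcs1 f -> bcs1 (fun x => f (x + c)).
Proof.
move=> bf; have [M M0 h] := bcsE bf; apply: (@bcsP _ _ _ _ _ M (M + `|c|)).
- by mfun.
- by move=> x; exact: (h _).1.
- move=> x hx; apply: (h _).2.
  by have := ler_normB (x + c) c; rewrite addrK; lra.
Qed.

Lemma bcs_autocorr (f : R -> R) : bcs1 f -> bcs2 (fun p => f p.2 * f (p.2 + p.1)).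
Proof.
move=> bf; have [M M0 h] := bcsE bf; apply: (@bcsP _ _ _ _ _ (M * M) (2 * M)).
- by mfun.
- by move=> p; rewrite normrM ler_pM//; exact: (h _).1.
- move=> [d t] /= hx.
  have [/(h _).2 ->|tM] := ltP M `|t|; first by rewrite mul0r.
  have [/(h _).2 ->|sM] := ltP M `|t + d|; first by rewrite mulr0.
  exfalso; move: hx; rewrite lt_max => /orP[|]; last by lra.
  by have := ler_normB (t + d) t; rewrite addrC addKr; lra.
Qed.

Lemma bcsN d (T : measurableType d) (N F : T -> R) : bcs N F ->
  bcs N (fun x => - F x).
Proof.
by move=> bF; rewrite (_ : (fun x => _) = fun x => (-1) * F x) ?mulN1r; [exact: bcsZ|apply/funext => x; rewrite mulN1r].
Qed.

(** After exchanging the integrals, the inner one over d is the full integral of [f] by translation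
    invariance. *)
Lemma Rintegral_autocorr (f : R -> R) : bcs1 f ->
  \int[mu]_d \int[mu]_t (f t * f (t + d)) = (\int[mu]_t f t) ^+ 2.
Proof.
move=> bf; rewrite (Rintegral_bcs2_swap (bcs_autocorr bf)) /=.
under eq_Rintegral => t _.
  under eq_Rintegral do rewrite addrC.
  rewrite RintegralZl//; last exact: bcs_integrable (bcs_shift t bf).
  rewrite -(Rintegral_shift t bf.1); over.
by rewrite RintegralZr//; exact: bcs_integrable bf.
Qed.

Lemma bcs_autocorr2 (k : R * R -> R) : bcs2 k ->
  bcs (fun p : R * R * R => Num.max (Num.max `|p.1.1| `|p.1.2|) `|p.2|)
    (fun p => k (p.1.1, p.2) * k (p.1.1, p.2 + p.1.2)).
Proof.
move=> bk; have [M M0 h] := bcsE bk; apply: (@bcsP _ _ _ _ _ (M * M) (2 * M)).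
- by mfun.
- by move=> p; rewrite normrM ler_pM//; exact: (h _).1.
- move=> [[u d] t] /= hx.
  have [/(h (u, t)).2 ->|] := ltP M (Num.max `|u| `|t|); first by rewrite mul0r.
  rewrite ge_max => /andP[uM tM].
  have [/(h (u, t + d)).2 ->|] := ltP M (Num.max `|u| `|t + d|); first by rewrite mulr0.
  rewrite ge_max => /andP[_ sM].
  exfalso; move: hx; rewrite !lt_max => /orP[/orP[|]|]; try by lra.
  by have := ler_normB (t + d) t; rewrite addrC addKr; lra.
Qed.

Lemma bcs_tt_star (k l : R * R -> R) : bcs2 k -> bcs2 l ->
  bcs1 (fun d => \int[mu]_u \int[mu]_t
    (k (u, t) * k (u, t + d) + l (u, t) * l (u, t + d))).
Proof.
move=> bk bl; have bP := @bcs_Rintegral _ _ _ (fun p : R * R => Num.max `|p.1| `|p.2|) _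
  (bcsD (bcs_autocorr2 bk) (bcs_autocorr2 bl)).
exact: bcs2_Rintegral1 bP.
Qed.

(** The kernel is k + i l, of which only the real part is on the left. Cauchy-Schwarz bounds it by
    the square of the integral of [k]; adding the square of the integral of [l] makes the integrand
    the real part of a product with a conjugate, which depends on phase differences only. *)
Lemma tt_star (G : R -> R) (k l : R * R -> R) : bcs1 G -> bcs2 k -> bcs2 l ->
  (\int[mu]_u \int[mu]_t (G u * k (u, t))) ^+ 2 <= (\int[mu]_u (G u ^+ 2)) *
  \int[mu]_d \int[mu]_u \int[mu]_t
    (k (u, t) * k (u, t + d) + l (u, t) * l (u, t + d)).
Proof.
move=> bG bk bl; have bck := bcs_Rintegral bk; have bcl := bcs_Rintegral bl.
under [X in X ^+ 2]eq_Rintegral => u _.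
  rewrite RintegralZl//; last exact: bcs_integrable (bcs_section u bk).
  over.
apply: le_trans (bcs_cauchy_schwarz bG bck) _.
apply: ler_wpM2l; first by apply: Rintegral_ge0 => u _; exact: sqr_ge0.
have bP := @bcs_Rintegral _ _ _ (fun p : R * R => Num.max `|p.1| `|p.2|) _
  (bcsD (bcs_autocorr2 bk) (bcs_autocorr2 bl)).
rewrite -(Rintegral_bcs2_swap bP) /=.
have E u : \int[mu]_d \int[mu]_t (k (u, t) * k (u, t + d) + l (u, t) * l (u, t + d)) =
    (\int[mu]_t k (u, t)) ^+ 2 + (\int[mu]_t l (u, t)) ^+ 2.
  have bku := bcs_section u bk; have blu := bcs_section u bl.
  rewrite -(Rintegral_autocorr bku) -(Rintegral_autocorr blu).
  rewrite -RintegralD//; last 2 first.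
    exact: bcs_integrable (bcs_Rintegral (bcs_autocorr bku)).
    exact: bcs_integrable (bcs_Rintegral (bcs_autocorr blu)).
  apply: eq_Rintegral => d _; rewrite -RintegralD//.
    exact: bcs_integrable (bcsM bku (bcs_shift d bku)).
  exact: bcs_integrable (bcsM blu (bcs_shift d blu)).
under [leRHS]eq_Rintegral do rewrite E.
have ik := bcsM bck bck; have il := bcsM bcl bcl.
apply: le_Rintegral => //.
- exact: bcs_integrable ik.
- exact: bcs_integrable (bcsD ik il).
- by move=> u _; rewrite lerDl sqr_ge0.
Qed.

Lemma integral_inv_oneDsqr :
  (\int[mu]_x (1 + x ^+ 2)^-1%:E = (trigo.pi : R)%:E)%E.
Proof.
have -> : (\int[mu]_x (1 + x ^+ 2)^-1%:E = \int[mu]_x ((oneDsqr x)^-1)%:E)%E by [].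
rewrite ge0_symfun_integralT.
- have -> : [set x : R | 0 <= x] = `[0, +oo[%classic.
    by apply/seteqP; split => x /=; rewrite in_itv/= andbT.
  by rewrite integral0y_oneDsqr -EFinM; congr EFin; lra.
- by move=> x; rewrite invr_ge0 ltW// oneDsqr_gt0.
- exact: continuous_oneDsqrV.
- by move=> x; rewrite /oneDsqr /= sqrrN.
Qed.

Lemma Rintegral_le_inv_oneDsqr (q : R -> R) (A c : R) : bcs1 q -> 0 <= A -> 0 < c ->
  (forall k, `|q k| <= A / (1 + (c * k) ^+ 2)) ->
  \int[mu]_k q k <= A * (trigo.pi / c).
Proof.
move=> bq A0 c0 hq.
have mD : measurable_fun setT (fun x : R => (1 + x ^+ 2)^-1%:E).
  apply/measurable_EFinP; apply: (@continuous_measurable_fun R (fun x => (oneDsqr x)^-1)).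
  exact: continuous_oneDsqrV.
have D0 (x : R) : (0 <= (1 + x ^+ 2)^-1%:E)%E.
  by rewrite lee_fin invr_ge0 addr_ge0 ?sqr_ge0.
have e1 := @ge0_integral_affine R c 0 _ (lt0r_neq0 c0) mD D0.
rewrite integral_inv_oneDsqr gtr0_norm// in e1.
have e2 : (\int[mu]_k (1 + (c * k) ^+ 2)^-1%:E = (trigo.pi / c)%:E)%E.
  have -> : (\int[mu]_k (1 + (c * k) ^+ 2)^-1%:E =
      \int[mu]_k (1 + (c * k + 0) ^+ 2)^-1%:E)%E.
    by apply: eq_integral => k _; rewrite addr0.
  (* Division by [c] in the extended reals: since c * I = pi is finite, the infinite values of [I]
     are excluded. *)
  move: e1; set I := integral _ _ _; case: I => [r| |].
  - by rewrite -EFinM => -[->]; congr EFin; field; rewrite gt_eqF.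
  - by rewrite gt0_muley ?lte_fin.
  - by rewrite gt0_muleNy ?lte_fin.
have mDc : measurable_fun setT (fun k : R => (1 + (c * k) ^+ 2)^-1).
  have -> : (fun k : R => (1 + (c * k) ^+ 2)^-1) = (fun k => (1 + (c * k + 0) ^+ 2)^-1).
    by apply/funext => k; rewrite addr0.
  apply: (@measurableT_comp _ _ _ _ _ _ (fun x : R => (1 + x ^+ 2)^-1)).
    by apply/measurable_EFinP.
  exact: measurable_affine.
have Dc0 (k : R) : 0 <= (1 + (c * k) ^+ 2)^-1 by rewrite invr_ge0 addr_ge0 ?sqr_ge0.
have iD : mu.-integrable setT (EFin \o (fun k : R => (1 + (c * k) ^+ 2)^-1)).
  apply/integrableP; split; first exact/measurable_EFinP.
  rewrite [X in (X < _)%E](_ : _ = \int[mu]_k (1 + (c * k) ^+ 2)^-1%:E)%E.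
    by rewrite e2 ltry.
  by apply: eq_integral => k _; rewrite /= ger0_norm.
have -> : trigo.pi / c = \int[mu]_k (1 + (c * k) ^+ 2)^-1 by rewrite /Rintegral e2.
rewrite -RintegralZl//; apply: le_Rintegral => //.
- exact: bcs_integrable.
- exact: (integrableZl measurableT A iD).
- by move=> k _; rewrite (le_trans (ler_norm _)).
Qed.


(* With [E = cs + i sn], [corr_re] and [corr_im] are the real and imaginary parts of
   [E(x, y)] times the conjugate of [E(x + h, y)]; [corr2] is the real part of
   the same expression formed from [corr_re + i corr_im] in the direction of [y]. *)
Definition corr_re (cs sn : R * R -> R) (h : R) (p : R * R) : R :=
  cs p * cs (p.1 + h, p.2) + sn p * sn (p.1 + h, p.2).
Definition corr_im (cs sn : R * R -> R) (h : R) (p : R * R) : R :=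
  sn p * cs (p.1 + h, p.2) - cs p * sn (p.1 + h, p.2).
Definition corr2 (cs sn : R * R -> R) (h k : R) (p : R * R) : R :=
  corr_re cs sn h p * corr_re cs sn h (p.1, p.2 + k) +
  corr_im cs sn h p * corr_im cs sn h (p.1, p.2 + k).

Definition normsq (f : R -> R) : R := \int[mu]_x (f x ^+ 2).

Lemma normsq_ge0 f : 0 <= normsq f.
Proof. by apply: Rintegral_ge0 => x _; exact: sqr_ge0. Qed.

(** The factor that replaces [g] when the square of an integral is expanded with shift [h]. *)
Definition shiftmul (g : R -> R) (h x : R) : R := g x * g (x + h).

Lemma bcs_shiftmul g h : bcs1 g -> bcs1 (shiftmul g h).
Proof. by move=> bg; exact: bcsM bg (bcs_shift h bg). Qed.

(** From |ab| <= (a^2 + b^2) / 2 and translation invariance; the bound is uniform in the shift. *)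
Lemma Rintegral_norm_shiftmul g h : bcs1 g ->
  \int[mu]_x `|shiftmul g h x| <= normsq g.
Proof.
move=> bg; have bs := bcs_shift h bg.
have b1 := bcsM bg bg; have b2 := bcsM bs bs.
have -> : normsq g = \int[mu]_x (2^-1 * (g x * g x + g (x + h) * g (x + h))).
  rewrite RintegralZl// ?(bcs_integrable (bcsD b1 b2))// RintegralD// ?bcs_integrable//.
  rewrite -(Rintegral_shift h b1.1) /normsq; under eq_Rintegral do rewrite expr2.
  lra.
apply: le_Rintegral => //.
- exact: bcs_integrable (bcs_norm (bcs_shiftmul h bg)).
- exact: bcs_integrable (bcsZ _ (bcsD b1 b2)).
- move=> x _; rewrite /shiftmul normrM.
  rewrite -!expr2 -(real_normK (num_real (g x))) -(real_normK (num_real (g (x + h)))).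
  by have := sqr_ge0 (`|g x| - `|g (x + h)|); nra.
Qed.

(** The integral over h is the autocorrelation identity for g^2. This is how two rounds of
    Cauchy-Schwarz still end with L^2 norms of the original functions. *)
Lemma normsq_shiftmulE g : bcs1 g ->
  bcs1 (fun h => normsq (shiftmul g h)) /\
  \int[mu]_h normsq (shiftmul g h) = normsq g ^+ 2.
Proof.
move=> bg; have bgg : bcs1 (fun x => g x ^+ 2) by exact: (bcsM bg bg).
have e h : normsq (shiftmul g h) = \int[mu]_t (g t ^+ 2 * g (t + h) ^+ 2).
  by apply: eq_Rintegral => x _; rewrite exprMn.
split; last by rewrite -(Rintegral_autocorr bgg); apply: eq_Rintegral => h _.
rewrite (_ : (fun h => _) = fun h => \int[mu]_t (g t ^+ 2 * g (t + h) ^+ 2)).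
  exact: bcs_Rintegral (bcs_autocorr bgg).
by apply/funext.
Qed.

Lemma bcs_sqrt (f : R -> R) : bcs1 f -> bcs1 (fun x => Num.sqrt (f x)).
Proof.
move=> bf; have [M M0 h] := bcsE bf; apply: (@bcsP _ _ _ _ _ (Num.sqrt M) M).
- apply: (@measurableT_comp _ _ _ _ _ _ (@Num.sqrt R)); last exact: bf.1.
  by apply: continuous_measurable_fun; exact: sqrt_continuous.
- move=> x; rewrite ger0_norm ?sqrtr_ge0// ler_wsqrtr//.
  by rewrite (le_trans (ler_norm _))//; exact: (h x).1.
- by move=> x /(h x).2 ->; rewrite sqrtr0.
Qed.

(** * The two applications of Cauchy-Schwarz, given a kernel bound *)

Section Core.
Variables (cs sn : R * R -> R) (A B : R).
Hypotheses (bcs_ : bcs2 cs) (bsn : bcs2 sn) (A0 : 0 <= A).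
Hypotheses (csB : forall p, `|cs p| <= B) (snB : forall p, `|sn p| <= B).
(** [nu] stands for |lambda|^(1/3); its cube is then the frequency in [kernel], and 1 / nu is the
    threshold between small and large shifts. *)
Variables (nu : R).
Hypotheses (nu0 : 0 < nu).
Hypothesis kernel : forall h k z,
  `|\int[mu]_x corr2 cs sn h k (x, z - x)| <= A / (1 + (nu ^+ 3 * `|h| * k) ^+ 2).

Let stage1 (g1 g2 : R -> R) (h : R) := \int[mu]_y \int[mu]_x
  (corr_re cs sn h (x, y) * shiftmul g1 h x * shiftmul g2 h (x + y)).

Lemma bcs2_shift1 (F : R * R -> R) (h : R) : bcs2 F -> bcs2 (fun p => F (p.1 + h, p.2)).
Proof.
move=> bF; have [M M0 hM] := bcsE bF; apply: (@bcsP _ _ _ _ _ M (M + `|h|)).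
- by mfun.
- by move=> x; exact: (hM _).1.
- move=> [x y] /= hx; apply: (hM _).2; move: hx; rewrite /= !lt_max => /orP[]hx; apply/orP.
    by left; have := ler_normB (x + h) h; rewrite addrK; lra.
  by right; have := normr_ge0 h; lra.
Qed.

Lemma bcs2_shear (F : R * R -> R) : bcs2 F -> bcs2 (fun p => F (p.1, p.2 - p.1)).
Proof.
move=> bF; have [M M0 hM] := bcsE bF; apply: (@bcsP _ _ _ _ _ M (2 * M)).
- by mfun.
- by move=> x; exact: (hM _).1.
- move=> [x y] /= hx; apply: (hM _).2; move: hx; rewrite /= !lt_max.
  have [?|xM] := ltP M `|x|; first by [].
  move=> /orP[|] hx /=; first lra.
  by have := ler_normD (y - x) x; rewrite subrK; lra.
Qed.

Lemma bcs2_corr_re h : bcs2 (corr_re cs sn h).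
Proof. by apply: bcsD; apply: bcsM => //; exact: bcs2_shift1. Qed.

Lemma bcs2_corr_im h : bcs2 (corr_im cs sn h).
Proof.
apply: bcsD; first by apply: bcsM => //; exact: bcs2_shift1.
by apply: bcsN; apply: bcsM => //; exact: bcs2_shift1.
Qed.

Lemma corr_re_le h p : `|corr_re cs sn h p| <= 2 * B ^+ 2.
Proof.
rewrite (le_trans (ler_normD _ _))// !normrM.
have h1 q r : `|cs q| * `|cs r| <= B ^+ 2 by rewrite expr2 ler_pM.
have h2 q r : `|sn q| * `|sn r| <= B ^+ 2 by rewrite expr2 ler_pM.
by have := h1 p (p.1 + h, p.2); have := h2 p (p.1 + h, p.2); lra.
Qed.

Lemma bcs2_shift2 (F : R * R -> R) (h : R) : bcs2 F -> bcs2 (fun p => F (p.1, p.2 + h)).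
Proof. by move=> /bcs2_swap /(bcs2_shift1 h) /bcs2_swap. Qed.

Lemma bcs2_mul_sum (f g : R -> R) : bcs1 f -> bcs1 g ->
  bcs2 (fun p => f p.1 * g (p.1 + p.2)).
Proof.
move=> bf bg; have [M M0 hM] := bcsE bf; have [M' M'0 hM'] := bcsE bg.
apply: (@bcsP _ _ _ _ _ (M * M') (M + M')).
- by mfun.
- by move=> x; rewrite normrM ler_pM//; [exact: (hM _).1|exact: (hM' _).1].
- move=> [x y] /=; rewrite lt_max => hx.
  have [/(hM _).2 ->|xM] := ltP M `|x|; first by rewrite mul0r.
  have [/(hM' _).2 ->|xM'] := ltP M' `|x + y|; first by rewrite mulr0.
  exfalso; move: hx => /orP[|]; first by lra.
  by have := ler_normB (x + y) x; rewrite addrC addKr; lra.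
Qed.

Lemma bcs2_stage1 g1 g2 h : bcs1 g1 -> bcs1 g2 ->
  bcs2 (fun p => corr_re cs sn h p * (shiftmul g1 h p.1 * shiftmul g2 h (p.1 + p.2))).
Proof.
move=> b1 b2; apply: bcsM; first exact: bcs2_corr_re.
exact: bcs2_mul_sum (bcs_shiftmul h b1) (bcs_shiftmul h b2).
Qed.

Lemma stage1E g1 g2 h : bcs1 g1 -> bcs1 g2 -> stage1 g1 g2 h =
  \int[mu]_x \int[mu]_y
    (corr_re cs sn h (x, y) * (shiftmul g1 h x * shiftmul g2 h (x + y))).
Proof.
move=> b1 b2; rewrite (Rintegral_bcs2_swap (bcs2_stage1 h b1 b2)) /stage1.
by apply: eq_Rintegral => y _; apply: eq_Rintegral => x _ /=; rewrite mulrA.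
Qed.

(** No oscillation is used: the translation y -> y - x separates the two shifted products, and each
    has L^1 norm at most the square of an L^2 norm. *)
Lemma stage1_le g1 g2 h : bcs1 g1 -> bcs1 g2 ->
  `|stage1 g1 g2 h| <= 2 * B ^+ 2 * (normsq g1 * normsq g2).
Proof.
move=> b1 b2; rewrite stage1E// -(Rintegral_bcs2 (bcs2_stage1 h b1 b2)).
have bs1 := bcs_norm (bcs_shiftmul h b1); have bs2 := bcs_norm (bcs_shiftmul h b2).
have bH := bcs2_mul_sum bs1 bs2.
have bF := bcs2_stage1 h b1 b2.
apply: le_trans (le_normr_Rintegral measurableT (bcs2_integrable bF)) _.
apply: (@le_trans _ _ (\int[(mu \x mu)%E]_p (2 * B ^+ 2 *
    (`|shiftmul g1 h p.1| * `|shiftmul g2 h (p.1 + p.2)|)))).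
  apply: le_Rintegral => //.
  - exact: bcs2_integrable (bcs_norm bF).
  - exact: bcs2_integrable (bcsZ _ bH).
  - by move=> p _; rewrite !normrM ler_wpM2r// corr_re_le.
rewrite RintegralZl//; last exact: bcs2_integrable bH.
apply: ler_wpM2l; first by rewrite mulr_ge0// sqr_ge0.
rewrite (Rintegral_bcs2 bH) /=.
under eq_Rintegral => x _.
  under eq_Rintegral do rewrite (addrC x).
  rewrite RintegralZl//; last exact: bcs_integrable (bcs_shift x bs2).
  rewrite -(Rintegral_shift x bs2.1); over.
rewrite RintegralZr//; last exact: bcs_integrable bs1.
by apply: ler_pM; rewrite ?Rintegral_norm_shiftmul//; apply: Rintegral_ge0.
Qed.

Lemma bcs2_snd (c : R * R -> R) (g : R -> R) : bcs2 c -> bcs1 g ->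
  bcs2 (fun p => c p * g p.2).
Proof.
move=> bc bg; have [M M0 hM] := bcsE bg.
rewrite [X in bcs _ X](_ : _ = fun p => g p.2 * c p); last first.
  by apply/funext => p; rewrite mulrC.
apply: (@bcs_mull _ _ _ _ _ (fun p : R * R => g p.2) M bc); first by mfun.
by move=> p; exact: (hM _).1.
Qed.

Lemma bcs2_corr2 h d : bcs2 (corr2 cs sn h d).
Proof.
apply: bcsD; apply: bcsM; try exact: bcs2_corr_re; try exact: bcs2_corr_im.
  exact: bcs2_shift2 (bcs2_corr_re h).
exact: bcs2_shift2 (bcs2_corr_im h).
Qed.

(** In the variables x and z = x + y, [tt_star] removes the factor in x and shifts z by d. The
    remaining factor depends on z alone, so the integral in x at fixed z is exactly the one that
    [kernel] bounds; its decay in d is integrable with total mass of order 1 / (nu^3 |h|). *)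
Lemma stage1_sqr_le g1 g2 h : bcs1 g1 -> bcs1 g2 -> h != 0 ->
  stage1 g1 g2 h ^+ 2 <= normsq (shiftmul g1 h) * (normsq (shiftmul g2 h) *
   (A * (trigo.pi / (nu ^+ 3 * `|h|)))).
Proof.
move=> b1 b2 h0; rewrite stage1E//.
have bs1 := bcs_shiftmul h b1; have bs2 := bcs_shiftmul h b2.
have bF := bcs2_stage1 h b1 b2.
pose k p := corr_re cs sn h (p.1, p.2 - p.1) * shiftmul g2 h p.2.
pose l p := corr_im cs sn h (p.1, p.2 - p.1) * shiftmul g2 h p.2.
have bk : bcs2 k := bcs2_snd (bcs2_shear (bcs2_corr_re h)) bs2.
have bl : bcs2 l := bcs2_snd (bcs2_shear (bcs2_corr_im h)) bs2.
have -> : \int[mu]_x \int[mu]_y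
      (corr_re cs sn h (x, y) * (shiftmul g1 h x * shiftmul g2 h (x + y))) =
    \int[mu]_x \int[mu]_z (shiftmul g1 h x * k (x, z)).
  apply: eq_Rintegral => x _; rewrite (Rintegral_shift (- x) (bcs_section x bF).1) /=.
  by apply: eq_Rintegral => z _; rewrite /k /= (_ : x + (z - x) = z); ring.
apply: le_trans (tt_star bs1 bk bl) _.
rewrite -/(normsq _); apply: ler_wpM2l; first exact: normsq_ge0.
rewrite mulrA [normsq _ * A]mulrC.
apply: Rintegral_le_inv_oneDsqr.
- exact: bcs_tt_star.
- by rewrite mulr_ge0// normsq_ge0.
- by rewrite mulr_gt0 ?exprn_gt0// normr_gt0.
move=> d.
have bkl : bcs2 (fun p => k p * k (p.1, p.2 + d) + l p * l (p.1, p.2 + d)).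
  by apply: bcsD; apply: bcsM => //; exact: bcs2_shift2.
have bC := bcs2_shear (bcs2_corr2 h d).
have bss := bcs_shiftmul d bs2.
rewrite [X in `|X|](_ : _ = \int[mu]_u \int[mu]_t
   (k (u, t) * k (u, t + d) + l (u, t) * l (u, t + d)))//.
rewrite (Rintegral_bcs2_swap bkl) /=.
have -> : \int[mu]_t \int[mu]_u (k (u, t) * k (u, t + d) + l (u, t) * l (u, t + d)) =
    \int[mu]_t (shiftmul (shiftmul g2 h) d t * \int[mu]_u corr2 cs sn h d (u, t - u)).
  apply: eq_Rintegral => t _; rewrite -RintegralZl//; last first.
    exact: bcs_integrable (bcs2_section1 t bC).
  apply: eq_Rintegral => u _; rewrite /k /l /corr2 /= addrAC.
  by rewrite [shiftmul (shiftmul _ _) _ _]/shiftmul; ring.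
have bI := bcs2_Rintegral1 bC.
apply: le_trans (le_normr_Rintegral measurableT (bcs_integrable (bcsM bss bI))) _.
apply: (@le_trans _ _ (\int[mu]_t (`|shiftmul (shiftmul g2 h) d t| *
    (A / (1 + (nu ^+ 3 * `|h| * d) ^+ 2))))).
  apply: le_Rintegral => //.
  - exact: bcs_integrable (bcs_norm (bcsM bss bI)).
  - apply: bcs_integrable; rewrite [X in bcs _ X](_ : _ = fun t =>
        A / (1 + (nu ^+ 3 * `|h| * d) ^+ 2) * `|shiftmul (shiftmul g2 h) d t|).
      exact: bcsZ _ (bcs_norm bss).
    by apply/funext => t; rewrite mulrC.
  - move=> t _; rewrite normrM; apply: ler_wpM2l => //; exact: kernel.
rewrite RintegralZr//; last exact: bcs_integrable (bcs_norm bss).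
set W := 1 + _ ^+ 2; rewrite (_ : A * _ / W = normsq (shiftmul g2 h) * (A / W)); last first.
  by rewrite mulrAC mulrC.
apply: ler_wpM2r; first by rewrite divr_ge0// addr_ge0 ?sqr_ge0.
exact: Rintegral_norm_shiftmul.
Qed.

(** [tt_star] in y removes [g0] and leaves the integral of [stage1] over the shift; [stage1_le]
    serves for shifts up to 1 / nu and [stage1_sqr_le] beyond. *)
Lemma core_estimate (g0 g1 g2 : R -> R) : bcs1 g0 -> bcs1 g1 -> bcs1 g2 ->
  (\int[mu]_y \int[mu]_x (g0 y * (cs (x, y) * (g1 x * g2 (x + y))))) ^+ 2 <=
  normsq g0 * ((4 * B ^+ 2 + Num.sqrt (A * trigo.pi)) / nu * (normsq g1 * normsq g2)).
Proof.
move=> b0 b1 b2.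
have b12 := bcs2_mul_sum b1 b2.
have bk := bcs2_swap (bcsM bcs_ b12); have bl := bcs2_swap (bcsM bsn b12).
apply: le_trans (tt_star b0 bk bl) _ => /=.
rewrite -/(normsq _); apply: ler_wpM2l; first exact: normsq_ge0.
have E d : \int[mu]_u \int[mu]_t
       (cs (t, u) * (g1 t * g2 (t + u)) * (cs (t + d, u) * (g1 (t + d) * g2 (t + d + u))) +
        sn (t, u) * (g1 t * g2 (t + u)) * (sn (t + d, u) * (g1 (t + d) * g2 (t + d + u)))) =
     stage1 g1 g2 d.
  apply: eq_Rintegral => y _; apply: eq_Rintegral => x _.
  by rewrite /corr_re /shiftmul /= [x + d + y]addrAC; ring.
have bS : bcs1 (stage1 g1 g2).
  rewrite -(funext E); exact: bcs_tt_star bk bl.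
rewrite (_ : \int[mu]_d _ = \int[mu]_d stage1 g1 g2 d); last first.
  by apply: eq_Rintegral => d _; exact: E.
pose V1 d := Num.sqrt (normsq (shiftmul g1 d)).
pose V2 d := Num.sqrt (normsq (shiftmul g2 d)).
have bV1 : bcs1 V1 := bcs_sqrt (normsq_shiftmulE b1).1.
have bV2 : bcs1 V2 := bcs_sqrt (normsq_shiftmulE b2).1.
pose box (d : R) : R := \1_(`[- nu^-1, nu^-1]%classic) d.
have nuV0 : 0 <= nu^-1 by rewrite invr_ge0 ltW.
have box0 (d : R) : nu^-1 < `|d| -> box d = 0.
  move=> hd; rewrite /box indicE memNset//= in_itv/= -ler_norml.
  by apply/negP; rewrite -ltNge.
have box_le1 (d : R) : `|box d| <= 1.
  by rewrite /box indicE; case: (_ \in _); rewrite ?normr0 ?normr1.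
have bbox : bcs1 box.
  apply: (@bcsP _ _ _ _ _ 1 nu^-1) => //.
  by apply: measurable_indic; exact: measurable_itv.
set N := normsq g1 * normsq g2; set S := Num.sqrt (A * trigo.pi).
have N0 : 0 <= N by rewrite mulr_ge0 ?normsq_ge0.
have S0 : 0 <= S by exact: sqrtr_ge0.
apply: (@le_trans _ _ (\int[mu]_d (2 * B ^+ 2 * N * box d + S / nu * (V1 d * V2 d)))).
  apply: le_Rintegral => //.
  - exact: bcs_integrable bS.
  - exact: bcs_integrable (bcsD (bcsZ _ bbox) (bcsZ _ (bcsM bV1 bV2))).
  move=> d _.
  have VV : 0 <= S / nu * (V1 d * V2 d) by rewrite !mulr_ge0 ?sqrtr_ge0.
  have [dle|dgt] := leP `|d| nu^-1.
    have -> : box d = 1 by rewrite /box indicE mem_set//= in_itv/= -ler_norml.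
    rewrite mulr1; apply: le_trans (ler_norm _) _.
    by have := stage1_le d b1 b2; rewrite -/N; lra.
  rewrite (box0 _ dgt) mulr0 add0r.
  have d0 : 0 < `|d| by exact: le_lt_trans dgt.
  have dn0 : d != 0 by rewrite -normr_gt0.
  apply: le_trans (ler_norm _) _; rewrite -ler_sqr ?nnegrE// real_normK ?num_real//.
  apply: le_trans (stage1_sqr_le b1 b2 dn0) _.
  rewrite !exprMn /V1 /V2 !sqr_sqrtr ?normsq_ge0//; last first.
    by rewrite mulr_ge0// trigo.pi_ge0.
  rewrite mulrA mulrC ler_wpM2r ?mulr_ge0 ?normsq_ge0// mulrA.
  rewrite ler_wpM2l ?mulr_ge0 ?trigo.pi_ge0//.
  rewrite exprVn lef_pV2 ?posrE ?mulr_gt0 ?exprn_gt0//.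
  (* Since nu |d| > 1, nu^3 |d| is at least nu^2, so the square root of the kernel mass is O(1 /
     nu). *)
  rewrite exprS mulrAC ler_peMl ?exprn_ge0 1?ltW//.
    by rewrite mulr_gt0 ?exprn_gt0.
  by rewrite -ltr_pdivrMl// mulr1.
rewrite RintegralD//; last 2 first.
- exact: bcs_integrable (bcsZ _ bbox).
- exact: bcs_integrable (bcsZ _ (bcsM bV1 bV2)).
rewrite RintegralZl ?(bcs_integrable bbox)// RintegralZl ?(bcs_integrable (bcsM bV1 bV2))//.
have H1 : \int[mu]_d box d <= 2 * nu^-1 * 1.
  by apply: le_trans (ler_norm _) (Rintegral_le_box bbox nuV0 box_le1 box0).
(* Cauchy-Schwarz in the shift: the integrals of V1^2 and V2^2 are fourth powers of L^2 norms by
   [normsq_shiftmulE]. *)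
have H2 : \int[mu]_d (V1 d * V2 d) <= N.
  have NN : 0 <= \int[mu]_d (V1 d * V2 d).
    by apply: Rintegral_ge0 => d _; rewrite mulr_ge0 ?sqrtr_ge0.
  rewrite -ler_sqr ?nnegrE//; apply: le_trans (bcs_cauchy_schwarz bV1 bV2) _.
  under eq_Rintegral do rewrite sqr_sqrtr ?normsq_ge0//.
  rewrite (normsq_shiftmulE b1).2.
  under eq_Rintegral do rewrite sqr_sqrtr ?normsq_ge0//.
  by rewrite (normsq_shiftmulE b2).2 exprMn.
have B2 : 0 <= 2 * B ^+ 2 * N.
  by apply: mulr_ge0 => //; apply: mulr_ge0 => //; exact: sqr_ge0.
have Sn : 0 <= S / nu by rewrite mulr_ge0.
have := ler_wpM2l B2 H1; have := ler_wpM2l Sn H2; lra.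
Qed.

End Core.
End TTstar.

(** * Nonstationary phase and the kernel bound *)

Section Nonstationary.
Context {R : realType}.
Local Notation mu := (@lebesgue_measure R).
Local Notation bcs1 := (bcs (@Num.norm R R)).
Implicit Types f g : R -> R.

Lemma is_derive_lamD f g (x df dg : R) : is_derive x 1 f df -> is_derive x 1 g dg ->
  is_derive x 1 (fun y => f y + g y) (df + dg).
Proof. by move=> hf hg; exact: is_deriveD. Qed.

Lemma is_derive_lamN f (x df : R) : is_derive x 1 f df ->
  is_derive x 1 (fun y => - f y) (- df).
Proof. by move=> hf; exact: is_deriveN. Qed.

Lemma is_derive_lamM f g (x df dg : R) : is_derive x 1 f df -> is_derive x 1 g dg ->
  is_derive x 1 (fun y => f y * g y) (df * g x + f x * dg).
Proof.
move=> hf hg; apply: is_derive_eq (is_deriveM hf hg) _.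
by rewrite /GRing.scale/=; ring.
Qed.

Lemma is_derive_lamZ f (x c df : R) : is_derive x 1 f df ->
  is_derive x 1 (fun y => c * f y) (c * df).
Proof. by move=> hf; exact: is_deriveZ. Qed.

Lemma is_derive_lamV f (x df : R) : f x != 0 -> is_derive x 1 f df ->
  is_derive x 1 (fun y => (f y)^-1) (- df * (f x)^-1 ^+ 2).
Proof.
move=> f0 hf; apply: is_derive_eq (is_deriveV f0 hf) _.
by rewrite /GRing.scale/= exprVn !mulNr mulrC.
Qed.

Lemma is_derive_lam_cos f (x df : R) : is_derive x 1 f df ->
  is_derive x 1 (fun y => cos (f y)) (- sin (f x) * df).
Proof. by move=> hf; exact: (is_derive1_comp (is_derive_cos _) hf). Qed.

Lemma is_derive_lam_sin f (x df : R) : is_derive x 1 f df ->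
  is_derive x 1 (fun y => sin (f y)) (cos (f x) * df).
Proof. by move=> hf; exact: (is_derive1_comp (is_derive_sin _) hf). Qed.

Lemma is_derive_continuous f (x df : R) : is_derive x 1 f df -> {for x, continuous f}.
Proof. by case=> /derivable1_diffP/differentiable_continuous. Qed.

Lemma is_derive_near0 f (x df : R) : is_derive x 1 f df -> (\forall y \near x, f y = 0) -> df = 0.
Proof.
move=> [df1 df2] f0; rewrite -df2 (near_eq_derive (g := cst 0)) ?derive_cst//.
Qed.

Lemma is_derive_of_near0 f (x : R) : (\forall y \near x, f y = 0) ->
  is_derive x 1 f 0.
Proof.
move=> f0; have e : \forall y \near x, cst 0 y = f y by apply: filterS f0 => y ->.
exact: near_eq_is_derive e (is_derive_cst 0 x 1).
Qed.

Lemma Rintegral_derive_bcs (H h : R -> R) (L : R) : bcs1 h -> continuous h ->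
  (forall x : R, is_derive x 1 H (h x)) -> (forall x, L < `|x| -> H x = 0) ->
  \int[mu]_x h x = 0.
Proof.
move=> bh ch dH H0; have [M M0 hM] := bcsE bh.
(* [r] exceeds both radii, so [H] vanishes at the endpoints and [h] outside the interval. *)
pose r := Num.max `|L| M + 1.
have rL : `|L| < r.
  have : `|L| <= Num.max `|L| M by rewrite le_max lexx.
  by rewrite /r; lra.
have rM : M < r.
  have : M <= Num.max `|L| M by rewrite le_max lexx orbT.
  by rewrite /r; lra.
have r0 : 0 < r by have := normr_ge0 L; lra.
have -> : h = h \_ `[- r, r].
  apply/funext => x; rewrite /patch; case: ifPn => // /negP hx.
  apply: (hM x).2; rewrite ltNge; apply/negP => xM; apply: hx.
  by rewrite inE/= in_itv/= -ler_norml; lra.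
rewrite -Rintegral_mkcond /Rintegral.
rewrite (continuous_FTC2 (F := H)).
- rewrite !H0 ?normrN ?sube0// gtr0_norm//; have := ler_norm L; lra.
- lra.
- by apply: continuous_subspaceT.
- split.
  + by move=> x _; case: (dH x).
  + apply: cvg_at_right_filter; exact: is_derive_continuous (dH _).
  + apply: cvg_at_left_filter; exact: is_derive_continuous (dH _).
- by move=> x _; rewrite derive1E; case: (dH x).
Qed.

Section IBP.
Variables (phi phi1 phi2 phi3 g g1 g2 : R -> R) (M G D m : R).
Hypotheses (dg : forall x : R, is_derive x 1 g (g1 x)) (dg1 : forall x : R, is_derive x 1 g1 (g2 x)).
Hypotheses (cg2 : continuous g2) (M0 : 0 <= M) (D0 : 0 <= D) (m0 : 0 < m).
Hypotheses (gG : forall x, `|g x| <= G) (g1G : forall x, `|g1 x| <= G)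
  (g2G : forall x, `|g2 x| <= G).
Hypothesis gM : forall x, M < `|x| -> g x = 0.
(** The alternative is pointwise because the phase need not even be continuous where the amplitude
    vanishes. Measuring the higher derivatives in units of the lower bound [m] makes the final bound
    scale as m^(-2). *)
Hypothesis phiP : forall x : R, (\forall y \near x, g y = 0) \/
  [/\ is_derive x 1 phi (phi1 x), is_derive x 1 phi1 (phi2 x), is_derive x 1 phi2 (phi3 x),
      {for x, continuous phi3} & [/\ m <= `|phi1 x|, `|phi2 x| <= D * m & `|phi3 x| <= D * m] ].

(** With r = 1 / phi', two integrations by parts use H = sin(phi) g r + cos(phi) r (g r)', whose
    derivative is cos(phi) (g + w) with w = (r (g r)')'. Both [w] and [H] are these expressions
    expanded. *)
Let r x := (phi1 x)^-1.
Let w x := g2 x * r x ^+ 2 - 3 * (g1 x * phi2 x * r x ^+ 3) - g x * phi3 x * r x ^+ 3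
   + 3 * (g x * phi2 x ^+ 2 * r x ^+ 4).
Let H x := sin (phi x) * (g x * r x) +
  cos (phi x) * (g1 x * (r x * r x) - g x * phi2 x * (r x * (r x * r x))).

Let near_g1 (x : R) : (\forall y \near x, g y = 0) -> (\forall y \near x, g1 y = 0).
Proof.
move=> /near_join; apply: filterS => y hy; exact: is_derive_near0 (dg y) hy.
Qed.

Let near_g2 (x : R) : (\forall y \near x, g y = 0) -> (\forall y \near x, g2 y = 0).
Proof.
move=> /near_g1/near_join; apply: filterS => y hy; exact: is_derive_near0 (dg1 y) hy.
Qed.

Let dH (x : R) : is_derive x 1 H (cos (phi x) * g x + cos (phi x) * w x).
Proof.
have [g0|[d0 d1 d2 c3 [b1 b2 b3]]] := phiP x.
  have g10 := near_g1 g0; have g20 := near_g2 g0.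
  rewrite /w (nbhs_singleton g0) (nbhs_singleton g10) (nbhs_singleton g20).
  rewrite !(mul0r, mulr0, subr0, addr0).
  apply: is_derive_of_near0.
  by near=> y; rewrite /H (near g0 y)// (near g10 y)// !(mul0r, mulr0, subr0, addr0).
have p0 : phi1 x != 0 by rewrite -normr_gt0 (lt_le_trans m0).
have dr := is_derive_lamV p0 d1; rewrite -/(r x) in dr.
have drr := is_derive_lamM dr dr.
have dT1 := is_derive_lamM (is_derive_lam_sin d0) (is_derive_lamM (dg x) dr).
have dT2 := is_derive_lamM (is_derive_lam_cos d0) (is_derive_lamD
  (is_derive_lamM (dg1 x) drr)
  (is_derive_lamN (is_derive_lamM (is_derive_lamM (dg x) d2) (is_derive_lamM dr drr)))).
apply: is_derive_eq (is_derive_lamD dT1 dT2) _.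
have pr : phi1 x = (r x)^-1 by rewrite /r invrK.
have r0 : r x != 0 by rewrite invr_eq0.
rewrite /w -/(r x) pr; field.
exact: r0.
Unshelve. all: by end_near. Qed.

Let ch_g (x : R) : {for x, continuous (fun x => cos (phi x) * g x)}.
Proof.
have [g0|[d0 _ _ _ _]] := phiP x; last first.
  exact: is_derive_continuous (is_derive_lamM (is_derive_lam_cos d0) (dg x)).
apply: is_derive_continuous; apply: is_derive_of_near0.
by near=> y; rewrite (near g0 y)// mulr0.
Unshelve. all: by end_near. Qed.

Let ch_w (x : R) : {for x, continuous (fun x => cos (phi x) * w x)}.
Proof.
have [g0|[d0 d1 d2 c3 [b1 b2 b3]]] := phiP x.
  have g10 := near_g1 g0; have g20 := near_g2 g0.
  apply: is_derive_continuous; apply: is_derive_of_near0.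
  near=> y; rewrite /w (near g0 y)// (near g10 y)// (near g20 y)//.
  by rewrite !(mul0r, mulr0, subr0, addr0).
have p0 : phi1 x != 0 by rewrite -normr_gt0 (lt_le_trans m0).
have cr : {for x, continuous r} := is_derive_continuous (is_derive_lamV p0 d1).
have cr2 : {for x, continuous (fun x => r x ^+ 2)} := continuousM cr cr.
have cr3 : {for x, continuous (fun x => r x ^+ 3)} := continuousM cr cr2.
have cr4 : {for x, continuous (fun x => r x ^+ 4)} := continuousM cr cr3.
have cg := is_derive_continuous (dg x); have cg1 := is_derive_continuous (dg1 x).
have c2 := is_derive_continuous d2.
apply: continuousM; first exact: is_derive_continuous (is_derive_lam_cos d0).
have c3' : {for x, continuous (fun _ : R => 3 : R)} by exact: cst_continuous.
have c22 : {for x, continuous (fun x => phi2 x ^+ 2)} := continuousM c2 c2.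
exact: (continuousD (continuousB (continuousB (continuousM (cg2 (x := x)) cr2)
  (continuousM c3' (continuousM (continuousM cg1 c2) cr3)))
  (continuousM (continuousM cg c3) cr3))
  (continuousM c3' (continuousM (continuousM cg c22) cr4))).
Unshelve. all: by end_near. Qed.

Let near_out (x : R) : M < `|x| -> \forall y \near x, g y = 0.
Proof.
move=> Mx.
have : \forall y \near x, M < `|y|.
  apply/nbhs_ballP; exists (`|x| - M); first by rewrite /= subr_gt0.
  by move=> y; rewrite -ball_normE /= => h; have := ler_normD (x - y) y; rewrite subrK; lra.
by apply: filterS => y; exact: gM.
Qed.

Lemma norm_cos_le1 (t : R) : `|cos t| <= 1.
Proof. by rewrite ler_norml cos_geN1 cos_le1. Qed.

(** Each factor phi'' or phi''' costs D m and is paid by one surplus factor r <= 1 / m in absolute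
    value, so every term is of order m^(-2). The coefficients are 1, 3 + 1 and 3. *)
Let w_le (x : R) : `|w x| <= G * (1 + 4 * D + 3 * D ^+ 2) / m ^+ 2.
Proof.
have G0 : 0 <= G by apply: le_trans (gG 0).
have [g0|[d0 d1 d2 c3 [b1 b2 b3]]] := phiP x.
  have g10 := near_g1 g0; have g20 := near_g2 g0.
  rewrite /w (nbhs_singleton g0) (nbhs_singleton g10) (nbhs_singleton g20).
  rewrite !(mul0r, mulr0, subr0, addr0) normr0.
  by rewrite divr_ge0 ?exprn_ge0 ?(ltW m0)// mulr_ge0// !addr_ge0// mulr_ge0// sqr_ge0.
have rm : `|r x| <= m^-1.
  by rewrite normfV lef_pV2 ?posrE// (lt_le_trans m0).
have rn n : `|r x ^+ n| <= m^-1 ^+ n by rewrite normrX lerXn2r ?nnegrE// invr_ge0 ltW.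
have mV : m * m^-1 = 1 by rewrite divff// gt_eqF.
have e1 : `|g2 x * r x ^+ 2| <= G * m^-1 ^+ 2 by rewrite normrM ler_pM.
have e2 : `|3 * (g1 x * phi2 x * r x ^+ 3)| <= 3 * D * G * m^-1 ^+ 2.
  rewrite normrM (ger0_norm (_ : 0 <= 3))//.
  apply: (@le_trans _ _ (3 * (G * (D * m) * m^-1 ^+ 3))).
    rewrite ler_wpM2l// normrM; apply: ler_pM => //.
    by rewrite normrM; exact: ler_pM.
  have -> : 3 * (G * (D * m) * m^-1 ^+ 3) = 3 * D * G * m^-1 ^+ 2 * (m * m^-1) by ring.
  by rewrite mV mulr1.
have e3 : `|g x * phi3 x * r x ^+ 3| <= D * G * m^-1 ^+ 2.
  apply: (@le_trans _ _ (G * (D * m) * m^-1 ^+ 3)).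
    rewrite normrM; apply: ler_pM => //.
    by rewrite normrM; exact: ler_pM.
  have -> : (G * (D * m) * m^-1 ^+ 3) = D * G * m^-1 ^+ 2 * (m * m^-1) by ring.
  by rewrite mV mulr1.
have e4 : `|3 * (g x * phi2 x ^+ 2 * r x ^+ 4)| <= 3 * D ^+ 2 * G * m^-1 ^+ 2.
  rewrite normrM (ger0_norm (_ : 0 <= 3))//.
  apply: (@le_trans _ _ (3 * (G * (D * m) ^+ 2 * m^-1 ^+ 4))).
    rewrite ler_wpM2l// normrM; apply: ler_pM => //.
    rewrite normrM; apply: ler_pM => //; rewrite normrX lerXn2r ?nnegrE//.
    by rewrite mulr_ge0// ltW.
  have -> : 3 * (G * (D * m) ^+ 2 * m^-1 ^+ 4) = 3 * D ^+ 2 * G * m^-1 ^+ 2 * (m * m^-1) ^+ 2 by ring.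
  by rewrite mV expr1n mulr1.
rewrite -exprVn.
have t1 := ler_normD (g2 x * r x ^+ 2 - 3 * (g1 x * phi2 x * r x ^+ 3) - g x * phi3 x * r x ^+ 3)
   (3 * (g x * phi2 x ^+ 2 * r x ^+ 4)).
have t2 := ler_normB (g2 x * r x ^+ 2 - 3 * (g1 x * phi2 x * r x ^+ 3)) (g x * phi3 x * r x ^+ 3).
have t3 := ler_normB (g2 x * r x ^+ 2) (3 * (g1 x * phi2 x * r x ^+ 3)).
rewrite /w; lra.
Qed.

(** [H] vanishes outside a bounded interval, so its derivative has integral zero and the integral of
    cos(phi) g equals minus that of cos(phi) w. *)
Lemma nonstationary_bound :
  `|\int[mu]_x (cos (phi x) * g x)| <= 2 * M * (G * (1 + 4 * D + 3 * D ^+ 2) / m ^+ 2).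
Proof.
have G0 : 0 <= G by apply: le_trans (gG 0).
have K0 : 0 <= 1 + 4 * D + 3 * D ^+ 2 by rewrite !addr_ge0// mulr_ge0// sqr_ge0.
have b1 : bcs1 (fun x => cos (phi x) * g x).
  apply: (@bcsP _ _ _ _ _ G M).
  - by apply: continuous_measurable_fun => x; exact: ch_g.
  - by move=> x; rewrite normrM -[leRHS]mul1r ler_pM ?norm_cos_le1//.
  - by move=> x /gM ->; rewrite mulr0.
have w0 x : M < `|x| -> w x = 0.
  move=> /near_out g0; have g10 := near_g1 g0; have g20 := near_g2 g0.
  rewrite /w (nbhs_singleton g0) (nbhs_singleton g10) (nbhs_singleton g20).
  by rewrite !(mul0r, mulr0, subr0, addr0).
have cw_le x : `|cos (phi x) * w x| <= G * (1 + 4 * D + 3 * D ^+ 2) / m ^+ 2.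
  by rewrite normrM -[leRHS]mul1r ler_pM ?norm_cos_le1//.
have cw0 x : M < `|x| -> cos (phi x) * w x = 0 by move=> /w0 ->; rewrite mulr0.
have b2 : bcs1 (fun x => cos (phi x) * w x).
  apply: (@bcsP _ _ _ _ _ _ M) => //.
  by apply: continuous_measurable_fun => x; exact: ch_w.
have ch : continuous (fun x : R => cos (phi x) * g x + cos (phi x) * w x).
  move=> x; by apply: cvgD; [exact: ch_g|exact: ch_w].
have e : \int[mu]_x (cos (phi x) * g x + cos (phi x) * w x) = 0.
  apply: (Rintegral_derive_bcs (bcsD b1 b2) (H := H) (L := M)) => //.
  move=> x /near_out g0; have g10 := near_g1 g0.
    rewrite /H (nbhs_singleton g0) (nbhs_singleton g10).
    by rewrite !(mul0r, mulr0, subr0, addr0).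
rewrite RintegralD ?bcs_integrable// in e.
rewrite (_ : \int[mu]_x (cos (phi x) * g x) = - \int[mu]_x (cos (phi x) * w x)); last by lra.
by rewrite normrN; exact: Rintegral_le_box.
Qed.

End IBP.
End Nonstationary.

(** * Mixed differences, convex hulls and compactness *)

Section Geometry.
Context {R : realType}.
Local Notation mu := (@lebesgue_measure R).
Local Notation bcs1 := (bcs (@Num.norm R R)).

Lemma is_derive_line (f : pt R -> R) (e v : pt R) (rho x : R) :
  derivable f (e + (x * rho) *: v) v ->
  is_derive x 1 (fun y => f (e + (y * rho) *: v)) (rho * 'D_v f (e + (x * rho) *: v)).
Proof.
set a := e + (x * rho) *: v => df.
pose F (h : R) := f (h *: v + a).
have dF : is_derive (0 : R) 1 F ('D_v f a).
  split; first exact: ((derivable1P f a v).1 df).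
  rewrite /derive.
  have -> : (fun h : R => h^-1 *: (F (h *: 1 + 0) - F 0)) =
      (fun h : R => h^-1 *: (f (h *: v + a) - f a)); last by [].
  apply/funext => h /=.
  by rewrite /F scale0r add0r addr0 /GRing.scale/= mulr1.
have dA : is_derive x 1 (fun y : R => (y - x) * rho) rho.
  apply: is_derive_eq (is_derive_lamM (is_derive_lamD (is_derive_id x 1)
    (is_derive_cst (- x) x 1)) (is_derive_cst rho x 1)) _.
  by rewrite /=; ring.
have dF' : is_derive ((x - x) * rho) 1 F ('D_v f a) by rewrite subrr mul0r.
have := @is_derive1_comp R F (fun y => (y - x) * rho) x _ _ dF' dA; rewrite mulrC.
rewrite (_ : F \o _ = fun y => f (e + (y * rho) *: v))//.
apply/funext => y; rewrite /= /F /a; congr f.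
by rewrite addrCA -scalerDl; congr (_ + _ *: _); ring.
Qed.

Lemma mvt_line (f : pt R -> R) (e v : pt R) (c : R) :
  (forall s, 0 <= s <= 1 -> derivable f (e + (s * c) *: v) v) ->
  exists2 s, 0 <= s <= 1 & f (e + c *: v) - f e = c * 'D_v f (e + (s * c) *: v).
Proof.
move=> df; pose F s := f (e + (s * c) *: v).
have dF (s : R) : 0 <= s <= 1 -> is_derive s 1 F (c * 'D_v f (e + (s * c) *: v)).
  by move=> s01; exact/is_derive_line/df.
have [||s + ] := @MVT_segment R F (fun s => c * 'D_v f (e + (s * c) *: v)) 0 1 ler01.
- by move=> x; rewrite in_itv/= => /andP[x0 x1]; apply: dF; rewrite !ltW.
- apply: derivable_within_continuous => x; rewrite in_itv/= => x01.
  by case: (dF x x01).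
rewrite in_itv/= => s01; rewrite /F mul1r mul0r scale0r addr0 subr0 mulr1 => e1.
by exists s.
Qed.

Definition dd (f : pt R -> R) (p00 p10 p01 p11 : pt R) : R :=
  f p00 - f p10 - f p01 + f p11.

(** The mean value theorem is applied first in t to the difference across the [v0] side, then in s
    to the derivative along [v1]. The derivatives come out in the order of [iterDir], so they never
    have to be commuted. *)
Lemma mixed_mvt (f : pt R -> R) (e v0 v1 : pt R) (a c : R) :
  (forall s t, 0 <= s <= 1 -> 0 <= t <= 1 ->
    derivable f (e + (s * a) *: v0 + (t * c) *: v1) v1) ->
  (forall s t, 0 <= s <= 1 -> 0 <= t <= 1 ->
    derivable ('D_v1 f) (e + (s * a) *: v0 + (t * c) *: v1) v0) ->
  exists s t, [/\ 0 <= s <= 1, 0 <= t <= 1 &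
    dd f e (e + a *: v0) (e + c *: v1) (e + a *: v0 + c *: v1) =
    a * c * 'D_v0 ('D_v1 f) (e + (s * a) *: v0 + (t * c) *: v1)].
Proof.
move=> d1 d2.
pose F t := f (e + a *: v0 + (t * c) *: v1) - f (e + (t * c) *: v1).
pose F' t := c * 'D_v1 f (e + a *: v0 + (t * c) *: v1) + - (c * 'D_v1 f (e + (t * c) *: v1)).
have dF (t : R) : 0 <= t <= 1 -> is_derive t 1 F (F' t).
  move=> t01; apply: is_derive_lamD; last apply: is_derive_lamN; apply: is_derive_line.
    by have := d1 1 t _ t01; rewrite mul1r; apply; rewrite ler01 lexx.
  by have := d1 0 t _ t01; rewrite mul0r scale0r addr0; apply; rewrite ler01 lexx.
have [||t + ] := @MVT_segment R F F' 0 1 ler01.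
- by move=> x; rewrite in_itv/= => /andP[x0 x1]; apply: dF; rewrite !ltW.
- apply: derivable_within_continuous => x; rewrite in_itv/= => x01.
  by case: (dF x x01).
rewrite in_itv/= => t01; rewrite /F mul1r mul0r scale0r !addr0 subr0 mulr1 => e1.
have [s s01] : exists2 s, 0 <= s <= 1 & 'D_v1 f (e + (t * c) *: v1 + a *: v0) -
    'D_v1 f (e + (t * c) *: v1) = a * 'D_v0 ('D_v1 f) (e + (t * c) *: v1 + (s * a) *: v0).
  apply: (@mvt_line ('D_v1 f) (e + (t * c) *: v1) v0 a) => s s01.
  by have := d2 s t s01 t01; rewrite [X in derivable _ X _ -> _]addrAC.
rewrite addrAC [e + _ + (s * a) *: v0]addrAC => e2.
exists s, t; split => //; rewrite -mulrA mulrCA -e2 /dd.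
by move: e1; rewrite /F'; lra.
Qed.

(** Two iterations contain every parallelogram with vertices in [A], stay inside the convex hull,
    and preserve compactness as continuous images. Derivatives of [S] are therefore bounded on
    [seg (seg K)] without Caratheodory's theorem. *)
Definition seg (A : set (pt R)) : set (pt R) :=
  [set z | exists p q t, [/\ A p, A q, 0 <= t <= 1 & z = (1 - t) *: p + t *: q]].

Lemma seg_convex (A C : set (pt R)) : convex2 C -> A `<=` C -> seg A `<=` C.
Proof.
move=> cC AC _ [p [q [t [Ap Aq t01 ->]]]].
exact: (cC p q t t01 (AC _ Ap) (AC _ Aq)).
Qed.

Lemma convex2_Conv (A : set (pt R)) : convex2 (Conv A).
Proof. by move=> p q t t01 H1 H2 B cB AB; exact: (cB p q t t01 (H1 B cB AB) (H2 B cB AB)). Qed.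

Lemma sub_Conv (A : set (pt R)) : A `<=` Conv A.
Proof. by move=> p Ap C _; exact. Qed.

Lemma seg_compact (A : set (pt R)) : compact A -> compact (seg A).
Proof.
move=> cA.
pose F (w : (pt R * pt R * R)%type) : pt R := (1 - w.2) *: w.1.1 + w.2 *: w.1.2.
have -> : seg A = F @` (A `*` A `*` `[0, 1]%classic).
  apply/seteqP; split => z.
    by move=> [p [q [t [Ap Aq t01 ->]]]]; exists (p, q, t).
  by move=> [[[p q] t] [[/= Ap Aq] t01] <-]; exists p, q, t.
apply: continuous_compact; last first.
  by apply: compact_setX; [exact: compact_setX|exact: segment_compact].
apply: continuous_subspaceT => w; apply: cvgD; apply: cvgZ.
- by apply: cvgB; [exact: cvg_cst|exact: cvg_snd].
- by apply: (@continuous_comp _ _ _ fst fst); exact: cvg_fst.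
- exact: cvg_snd.
- by apply: (@continuous_comp _ _ _ fst snd); [exact: cvg_fst|exact: cvg_snd].
Qed.

Lemma compact_le (K : set (pt R)) (f : pt R -> R) : compact K ->
  (forall p, K p -> {for p, continuous f}) ->
  exists2 B, 0 <= B & forall p, K p -> `|f p| <= B.
Proof.
move=> cK cf.
have cfK : compact (f @` K).
  apply: continuous_compact => //; apply: continuous_in_subspaceT => p.
  by rewrite inE; exact: cf.
have [B [Br hB]] := compact_bounded cfK.
exists (`|B| + 1) => [|p Kp]; first by rewrite addr_ge0.
apply: (hB (`|B| + 1)); last by exists p.
by have := ler_norm B; lra.
Qed.

Lemma continuous_near0 (T : topologicalType) (f : T -> R) (x : T) :
  (\forall y \near x, f y = 0) -> {for x, continuous f}.
Proof.
move=> f0; rewrite /prop_for /continuous_at (nbhs_singleton f0).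
have e : \forall y \near x, cst 0 y = f y by apply: filterS f0 => y ->.
apply: cvg_trans (near_eq_cvg e) _; exact: cvg_cst.
Qed.

Lemma derive_near0 (f : pt R -> R) (p v : pt R) : (\forall q \near p, f q = 0) ->
  'D_v f p = 0.
Proof.
move=> f0; rewrite (near_eq_derive (g := cst 0)) ?derive_cst//.
Qed.


Lemma continuous_line (f : pt R -> R) (e v : pt R) (rho : R) (x : R) :
  {for (e + (x * rho) *: v), continuous f} ->
  {for x, continuous (fun y : R => f (e + (y * rho) *: v))}.
Proof.
move=> cf; apply: (@continuous_comp _ _ _ (fun y : R => e + (y * rho) *: v) f) => //.
apply: cvgD; first exact: cvg_cst.
apply: cvgZr_tmp; apply: cvgM; [exact: cvg_id|exact: cvg_cst].
Qed.

(** The functions are of class C^2 with one common bound; in [jet2M] the factor 4 counts the terms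
    of the second derivative of a product. *)
Definition jet2 (G : R) (f f1 f2 : R -> R) :=
  [/\ forall x : R, is_derive x 1 f (f1 x), forall x : R, is_derive x 1 f1 (f2 x), continuous f2 &
      forall x : R, [/\ `|f x| <= G, `|f1 x| <= G & `|f2 x| <= G]].

Lemma jet2M (G G' : R) (f f1 f2 h h1 h2 : R -> R) : jet2 G f f1 f2 -> jet2 G' h h1 h2 ->
  jet2 (4 * (G * G')) (fun x => f x * h x) (fun x => f1 x * h x + f x * h1 x)
    (fun x => (f2 x * h x + f1 x * h1 x) + (f1 x * h1 x + f x * h2 x)).
Proof.
move=> [df df1 cf2 Gf] [dh dh1 ch2 Gh]; split.
- by move=> x; exact: is_derive_lamM.
- by move=> x; apply: is_derive_lamD; exact: is_derive_lamM.
- move=> x.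
  have c0 := is_derive_continuous (df x); have c1 := is_derive_continuous (df1 x).
  have d0 := is_derive_continuous (dh x); have d1 := is_derive_continuous (dh1 x).
  by do 2 apply: cvgD; apply: cvgM => //; [exact: cf2|exact: ch2].
- move=> x; have [f0 g1 g2] := Gf x; have [k0 k1 k2] := Gh x.
  have le (a c : R) : `|a| <= G -> `|c| <= G' -> `|a * c| <= G * G'.
    by move=> ? ?; rewrite normrM ler_pM.
  have P0 : 0 <= G * G' by rewrite (le_trans _ (le _ _ f0 k0)).
  split.
  + by have := le _ _ f0 k0; lra.
  + by rewrite (le_trans (ler_normD _ _))//; have := le _ _ g1 k0; have := le _ _ f0 k1; lra.
  + rewrite (le_trans (ler_normD _ _))//.
    have := ler_normD (f2 x * h x) (f1 x * h1 x).
    have := ler_normD (f1 x * h1 x) (f x * h2 x).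
    have := le _ _ g2 k0; have := le _ _ g1 k1; have := le _ _ f0 k2; lra.
Qed.

(** * The oscillatory kernel on lines parallel to v_3 *)

Section Kernel.
Variables (v0 v1 v2 w0 w1 : pt R) (rho0 rho1 rho : R) (S b : pt R -> R)
  (U K : set (pt R)) (M : R).
Hypotheses (w0E : w0 = rho0 *: v0) (w1E : w1 = rho1 *: v1) (w01E : w0 - w1 = rho *: v2).
Hypotheses (r0n0 : rho0 != 0) (r1n0 : rho1 != 0) (rn0 : rho != 0).
Hypotheses (sS : smooth_on U S) (sb : smooth_on setT b) (cK : compact K).
Hypotheses (KU : Conv K `<=` U) (bK : forall p, b p != 0 -> K p).
Hypothesis lowS : forall p, Conv K p -> 1 <= `|iterDir [:: v0; v1; v2] S p|.
Hypothesis M0 : 0 <= M.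
Hypothesis KM : forall x y : R, K (x *: w0 + y *: w1) -> `|x| <= M /\ `|y| <= M.

Definition wave_re (lam : R) (p : R * R) :=
  cos (lam * S (p.1 *: w0 + p.2 *: w1)) * b (p.1 *: w0 + p.2 *: w1).
Definition wave_im (lam : R) (p : R * R) :=
  sin (lam * S (p.1 *: w0 + p.2 *: w1)) * b (p.1 *: w0 + p.2 *: w1).

Let bn n := iterDir (nseq n v2) b.

Let openCK : open (~` K).
Proof. by apply: closed_openC; apply: compact_closed => //; exact: norm_hausdorff. Qed.

Let bn0 n p : ~ K p -> bn n p = 0.
Proof.
elim: n p => [|n IH] p nKp.
  by apply/eqP/negPn/negP => /bK.
apply: derive_near0; apply: filterS (open_nbhs_nbhs (conj openCK nKp)) => q.
exact: IH.
Qed.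

Let bK0 p : ~ K p -> b p = 0.
Proof. exact: (bn0 0). Qed.

Let cbn n : continuous (bn n).
Proof. by move=> p; exact: (sb.2 (nseq n v2) p I).1. Qed.

Let bnG n : exists2 G, 0 <= G & forall p, `|bn n p| <= G.
Proof.
have cn p : K p -> {for p, continuous (bn n)} by move=> _; exact: cbn.
have [G G0 hG] := compact_le cK cn.
exists G => // p; have [/hG//|nKp] := pselect (K p).
by rewrite bn0 ?normr0.
Qed.

(** Off [K], where [S] is arbitrary, the product is locally zero because [K] is closed; on [K] the
    phase is continuous. *)
Lemma continuous_wave lam (trg : R -> R) : continuous trg ->
  continuous (fun p : pt R => trg (lam * S p) * b p).
Proof.
move=> ctrg p.
have [Kp|nKp] := pselect (K p); last first.
  apply: continuous_near0; apply: filterS (open_nbhs_nbhs (conj openCK nKp)) => q nKq.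
  by rewrite (bK0 nKq) mulr0.
have Up : U p := KU (sub_Conv Kp).
have cb : continuous b by move=> q; exact: (@cbn 0%N).
apply: cvgM; last exact: cb.
apply: (@continuous_comp _ _ _ (fun p : pt R => lam * S p) trg); last exact: ctrg.
by apply: cvgM; [exact: cvg_cst|exact: (sS.2 [::] _ Up).1].
Qed.

Lemma wave_bcs : exists2 B, 0 <= B & forall lam,
  [/\ continuous (wave_re lam), continuous (wave_im lam),
   forall p, `|wave_re lam p| <= B /\ `|wave_im lam p| <= B &
   forall p, M < Num.max `|p.1| `|p.2| -> wave_re lam p = 0 /\ wave_im lam p = 0].
Proof.
have [G G0 hG] := bnG 0; exists G => // lam.
have cpt : continuous (fun p : R * R => p.1 *: w0 + p.2 *: w1 : pt R).
  by move=> p; apply: cvgD; apply: cvgZr_tmp; [exact: cvg_fst|exact: cvg_snd].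
split.
- move=> p; apply: (@continuous_comp _ _ _ (fun p : R * R => p.1 *: w0 + p.2 *: w1 : pt R)
    (fun p : pt R => cos (lam * S p) * b p)); first exact: cpt.
  exact: (@continuous_wave lam cos (@continuous_cos R)).
- move=> p; apply: (@continuous_comp _ _ _ (fun p : R * R => p.1 *: w0 + p.2 *: w1 : pt R)
    (fun p : pt R => sin (lam * S p) * b p)); first exact: cpt.
  exact: (@continuous_wave lam sin (@continuous_sin R)).
- move=> p; split; rewrite normrM -[leRHS]mul1r; apply: ler_pM => //; try exact: hG.
    exact: norm_cos_le1.
  by rewrite ler_norml sin_geN1 sin_le1.
- move=> [x y] /= hxy.
  have nKp : ~ K (x *: w0 + y *: w1).
    by move=> /KM[xM yM]; move: hxy; rewrite lt_max !ltNge xM yM.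
  by rewrite /wave_re /wave_im /=; rewrite (bK0 nKp) !mulr0.
Qed.

Lemma bcs_wave_re lam : bcs (fun p : R * R => Num.max `|p.1| `|p.2|) (wave_re lam).
Proof.
have [B B0 hw] := wave_bcs; have [c1 _ hB h0] := hw lam.
apply: (@bcsP _ _ _ _ _ B M); first exact: continuous2_measurable.
  by move=> p; exact: (hB p).1.
by move=> p hp; exact: (h0 p hp).1.
Qed.

Lemma bcs_wave_im lam : bcs (fun p : R * R => Num.max `|p.1| `|p.2|) (wave_im lam).
Proof.
have [B B0 hw] := wave_bcs; have [_ c2 hB h0] := hw lam.
apply: (@bcsP _ _ _ _ _ B M); first exact: continuous2_measurable.
  by move=> p; exact: (hB p).2.
by move=> p hp; exact: (h0 p hp).2.
Qed.

Let sub_segK : seg (seg K) `<=` Conv K.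
Proof. by do 2 apply: seg_convex (@convex2_Conv K) _; exact: sub_Conv. Qed.

(** Applied to the n-th derivative of [S] along [v2]: for n = 1 the derivative on the right is the
    one bounded below, for n = 2 and 3 it is bounded by compactness, always with the same factor h
    k. *)
Lemma dd_mixed n (p : pt R) (h k : R) :
  K p -> K (p + h *: w0) -> K (p + k *: w1) -> K (p + h *: w0 + k *: w1) ->
  exists2 q, seg (seg K) q & dd (iterDir (nseq n v2) S) p (p + h *: w0) (p + k *: w1)
    (p + h *: w0 + k *: w1) =
    (h * rho0) * (k * rho1) * iterDir [:: v0, v1 & nseq n v2] S q.
Proof.
rewrite w0E w1E !scalerA => K00 K10 K01 K11.
set a := h * rho0; set c := k * rho1.
have inseg s t : 0 <= s <= 1 -> 0 <= t <= 1 -> seg (seg K) (p + (s * a) *: v0 + (t * c) *: v1).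
  move=> s01 t01.
  (* A point of the parallelogram lies on a segment joining points of two opposite sides. *)
  exists (p + (s * a) *: v0), (p + c *: v1 + (s * a) *: v0), t; split => //.
  - by exists p, (p + a *: v0), s; split => //; apply: injective_projections; rewrite /= /GRing.scale/=; ring.
  - exists (p + c *: v1), (p + a *: v0 + c *: v1), s; split => //.
    by apply: injective_projections; rewrite /= /GRing.scale/=; ring.
  - by apply: injective_projections; rewrite /= /GRing.scale/=; ring.
have inU s t : 0 <= s <= 1 -> 0 <= t <= 1 -> U (p + (s * a) *: v0 + (t * c) *: v1).
  by move=> s01 t01; exact: (KU (sub_segK (inseg s t s01 t01))).
have [||s [t [s01 t01 e]]] := @mixed_mvt (iterDir (nseq n v2) S) p v0 v1 a c.
- by move=> s t s01 t01; exact: (sS.2 (nseq n v2) _ (inU s t s01 t01)).2.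
- by move=> s t s01 t01; exact: (sS.2 (v1 :: nseq n v2) _ (inU s t s01 t01)).2.
exists (p + (s * a) *: v0 + (t * c) *: v1); first exact: inseg.
exact: e.
Qed.

(** [corr2] is the real part of a product of four waves, two of them conjugated; their phases add up
    to the mixed difference. *)
Lemma wave_corr2E lam h k (x y : R) (p := x *: w0 + y *: w1) :
  corr2 (wave_re lam) (wave_im lam) h k (x, y) =
  cos (lam * dd S p (p + h *: w0) (p + k *: w1) (p + h *: w0 + k *: w1)) *
  ((b p * b (p + h *: w0)) * (b (p + k *: w1) * b (p + h *: w0 + k *: w1))).
Proof.
rewrite /corr2 /corr_re /corr_im /wave_re /wave_im /=.
have -> : (x + h) *: w0 + y *: w1 = p + h *: w0 by rewrite /p scalerDl addrAC.
have -> : x *: w0 + (y + k) *: w1 = p + k *: w1 by rewrite /p scalerDl addrA.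
have -> : (x + h) *: w0 + (y + k) *: w1 = p + h *: w0 + k *: w1.
  by rewrite /p !scalerDl addrA; congr (_ + _); rewrite addrAC.
rewrite -/p /dd.
set A0 := S p; set A1 := S (p + h *: w0); set A2 := S (p + k *: w1).
set A3 := S (p + h *: w0 + k *: w1).
have -> : lam * (A0 - A1 - A2 + A3) = (lam * A0 - lam * A1) - (lam * A2 - lam * A3) by ring.
rewrite !cosB !sinB; ring.
Qed.

Let jetb : exists2 G, 0 <= G & forall e : pt R, jet2 G (fun x => b (e + (x * rho) *: v2))
  (fun x => rho * bn 1 (e + (x * rho) *: v2))
  (fun x => rho * (rho * bn 2 (e + (x * rho) *: v2))).
Proof.
have [G0 G00 hG0] := bnG 0; have [G1 G10 hG1] := bnG 1; have [G2 G20 hG2] := bnG 2.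
have r0 : 0 <= `|rho| by [].
exists (G0 + `|rho| * G1 + `|rho| * (`|rho| * G2)).
  by rewrite !addr_ge0 ?mulr_ge0.
move=> e; split.
- by move=> x; apply: is_derive_line; exact: (sb.2 [::] _ I).2.
- by move=> x; apply: is_derive_lamZ; apply: is_derive_line; exact: (sb.2 [:: v2] _ I).2.
- move=> x; do 2 (apply: cvgM; first exact: cvg_cst).
  by apply: (@continuous_line (bn 2)); exact: cbn.
- move=> x; rewrite !normrM.
  set q := e + _.
  have h0 := hG0 q; have h1 := ler_wpM2l r0 (hG1 q).
  have h2 := ler_wpM2l r0 (ler_wpM2l r0 (hG2 q)).
  have p1 : 0 <= `|rho| * G1 by rewrite mulr_ge0.
  have p2 : 0 <= `|rho| * (`|rho| * G2) by rewrite !mulr_ge0.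
  split; [|lra|lra].
  by move: h0; rewrite /bn /= => h0; lra.
Qed.

Lemma kernel_bound : exists2 A, 0 <= A & forall lam, lam != 0 -> forall h k z,
  `|\int[mu]_x corr2 (wave_re lam) (wave_im lam) h k (x, z - x)| <=
  A / (1 + (`|lam| * `|h| * k) ^+ 2).
Proof.
have [G G0 jb] := jetb.
have cK2 : compact (seg (seg K)) by do 2 apply: seg_compact.
have cS n p : seg (seg K) p -> {for p, continuous (iterDir [:: v0, v1 & nseq n v2] S)}.
  by move=> /sub_segK/KU Up; exact: (sS.2 _ p Up).1.
have [B2 B20 hB2] := compact_le cK2 (cS 2); have [B3 B30 hB3] := compact_le cK2 (cS 3).
(* Parametrising the line by x gives one factor [rho] per derivative; relative to the first
   derivative, the second has one more and the third two more. *)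
pose D := `|rho| * B2 + `|rho| ^+ 2 * B3.
have D0 : 0 <= D by rewrite addr_ge0// mulr_ge0// exprn_ge0.
pose c := `|rho| * `|rho0| * `|rho1|.
have c0 : 0 < c by rewrite !mulr_gt0 ?normr_gt0.
pose GG := 4 * (4 * (G * G) * (4 * (G * G))).
have GG0 : 0 <= GG by rewrite !mulr_ge0.
pose L := 1 + 4 * D + 3 * D ^+ 2.
have L0 : 0 <= L by rewrite !addr_ge0// mulr_ge0// exprn_ge0.
(* With X = |lambda| |h| k, the trivial bound serves for X^2 <= 1 and integration by parts for X^2 >
   1. The outer 2 bounds 1 + X^2 in the first case and 1 + X^(-2) in the second. *)
exists (2 * (2 * M * GG + 2 * M * (GG * L) / c ^+ 2)).
  by rewrite mulr_ge0// addr_ge0// ?divr_ge0 ?mulr_ge0// exprn_ge0// ltW.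
move=> lam lam0 h k z.
pose e := z *: w1.
pose q (u : pt R) (x : R) := u + (x * rho) *: v2.
have qE (x : R) : x *: w0 + (z - x) *: w1 = q e x.
  by rewrite /q -scalerA -w01E /e scalerBl scalerBr addrCA.
pose g x := (b (q e x) * b (q (e + h *: w0) x)) *
  (b (q (e + k *: w1) x) * b (q (e + h *: w0 + k *: w1) x)).
have [dg dg1 cg2 gG] := jet2M (jet2M (jb e) (jb (e + h *: w0)))
  (jet2M (jb (e + k *: w1)) (jb (e + h *: w0 + k *: w1))).
(* The n-th derivative in x of the phase along the line x + y = z. *)
pose phi n x := lam * (rho ^+ n * dd (iterDir (nseq n v2) S) (q e x) (q (e + h *: w0) x)
  (q (e + k *: w1) x) (q (e + h *: w0 + k *: w1) x)).
have a1 x : q e x + h *: w0 = q (e + h *: w0) x by rewrite /q addrAC.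
have a2 x : q e x + k *: w1 = q (e + k *: w1) x by rewrite /q addrAC.
have a3 x : q e x + h *: w0 + k *: w1 = q (e + h *: w0 + k *: w1) x.
  by rewrite a1 /q addrAC.
have corrE x : corr2 (wave_re lam) (wave_im lam) h k (x, z - x) = cos (phi 0%N x) * g x.
  rewrite wave_corr2E qE /phi /g expr0 mul1r.
  by rewrite a3 a1 a2.
under eq_Rintegral do rewrite corrE.
have gM x : M < `|x| -> g x = 0.
  move=> hx; rewrite /g -qE; have -> : b (x *: w0 + (z - x) *: w1) = 0.
    by apply/eqP/negPn/negP => /bK /KM[]; rewrite leNgt hx.
  by rewrite !mul0r.
have bC : bcs1 (fun x => cos (phi 0%N x) * g x).
  have := bcs2_section1 z (bcs2_shear (bcs2_corr2 (bcs_wave_re lam) (bcs_wave_im lam) h k)).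
  by rewrite (_ : (fun x => _) = fun x => cos (phi 0%N x) * g x)//; apply/funext => x; exact: corrE.
set X := `|lam| * `|h| * k.
have X1 : 0 < 1 + X ^+ 2 by have := sqr_ge0 X; lra.
have trivial_bound : `|\int[mu]_x (cos (phi 0%N x) * g x)| <= 2 * M * GG.
  apply: Rintegral_le_box => //.
    by move=> x; rewrite normrM -[leRHS]mul1r ler_pM ?norm_cos_le1//; case: (gG x).
  by move=> x /gM ->; rewrite mulr0.
have P0 : 0 <= 2 * M * GG by rewrite !mulr_ge0.
have Q0 : 0 <= 2 * M * (GG * L) / c ^+ 2.
  by rewrite ?divr_ge0 ?mulr_ge0// exprn_ge0// ltW.
rewrite ler_pdivlMr//.
have [Xle|Xgt] := leP (X ^+ 2) 1.
  have := ler_wpM2r (ltW X1) trivial_bound; nra.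
pose m := c * `|X|.
have Xn0 : X != 0 by apply/negP => /eqP X0; move: Xgt; rewrite X0 expr0n/=; lra.
have m0 : 0 < m by rewrite mulr_gt0 ?normr_gt0.
have mE : m = `|lam * rho * ((h * rho0) * (k * rho1))|.
  by rewrite /m /c /X !normrM !normr_id; ring.
have main : `|\int[mu]_x (cos (phi 0%N x) * g x)| <= 2 * M * (GG * L / m ^+ 2).
  apply: (nonstationary_bound (phi1 := phi 1%N) (phi2 := phi 2%N) (phi3 := phi 3%N) dg dg1 cg2 M0 D0 m0) => //.
  - by move=> x; case: (gG x).
  - by move=> x; case: (gG x).
  - by move=> x; case: (gG x).
  move=> x.
  have near_q u : ~ K (q u x) -> \forall y \near x, b (q u y) = 0.
    move=> nK.
    have cq : {for x, continuous (q u : R -> pt R)}.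
      apply: cvgD; first exact: cvg_cst.
      by apply: cvgZr_tmp; apply: cvgM; [exact: cvg_id|exact: cvg_cst].
    have hn : \forall y \near x, (~` K) (q u y) := cq _ (open_nbhs_nbhs (conj openCK nK)).
    apply: filterS hn => y /= nKy.
    exact: bK0.
  (* If one of the four vertices is off [K], the amplitude vanishes near x; otherwise the whole
     parallelogram lies in the hull and the phase is controlled. *)
  have [K00|/near_q h0] := pselect (K (q e x)); last first.
    by left; apply: filterS h0 => y hy; rewrite /g hy !mul0r.
  have [K10|/near_q h0] := pselect (K (q (e + h *: w0) x)); last first.
    by left; apply: filterS h0 => y hy; rewrite /g hy mulr0 mul0r.
  have [K01|/near_q h0] := pselect (K (q (e + k *: w1) x)); last first.
    by left; apply: filterS h0 => y hy; rewrite /g hy mul0r mulr0.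
  have [K11|/near_q h0] := pselect (K (q (e + h *: w0 + k *: w1) x)); last first.
    by left; apply: filterS h0 => y hy; rewrite /g hy !mulr0.
  right.
  have KU' r : K r -> U r by move=> Kr; exact: (KU (sub_Conv Kr)).
  have dphi n : is_derive x 1 (phi n) (phi n.+1 x).
    have dq u : K (q u x) -> is_derive x 1 (fun y => iterDir (nseq n v2) S (q u y))
        (rho * iterDir (nseq n.+1 v2) S (q u x)).
      by move=> /KU' Uq; apply: is_derive_line; exact: (sS.2 _ _ Uq).2.
    apply: is_derive_eq (is_derive_lamZ lam (is_derive_lamZ (rho ^+ n)
      (is_derive_lamD (is_derive_lamD (is_derive_lamD (dq _ K00) (is_derive_lamN (dq _ K10)))
       (is_derive_lamN (dq _ K01))) (dq _ K11)))) _.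
    by rewrite /phi /dd exprS; ring.
  have ddE n : exists2 r, seg (seg K) r & phi n x =
      lam * (rho ^+ n * ((h * rho0) * (k * rho1) * iterDir [:: v0, v1 & nseq n v2] S r)).
    have := @dd_mixed n (q e x) h k; rewrite a3 a1 a2 => /(_ K00 K10 K01 K11)[r Kr hr].
    by exists r => //; rewrite /phi hr.
  split; [exact: dphi|exact: dphi|exact: dphi| |split].
  - have cq n u : K (q u x) -> {for x, continuous (fun y : R => iterDir (nseq n v2) S (q u y))}.
      by move=> /KU' Uq; apply: continuous_line; exact: (sS.2 _ _ Uq).1.
    do 2 (apply: cvgM; first exact: cvg_cst).
    by apply: cvgD; [apply: cvgB; [apply: cvgB|]|]; exact: cq.
  - have [r Kr ->] := ddE 1%N.
    have := lowS (sub_segK Kr) => /= h1.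
    rewrite (_ : lam * _ = lam * rho * (h * rho0 * (k * rho1)) * iterDir [:: v0; v1; v2] S r).
      by rewrite normrM -mE ler_peMr// ltW.
    by rewrite expr1 /=; ring.
  - have [r Kr ->] := ddE 2%N.
    rewrite (_ : lam * _ = rho * (lam * rho * (h * rho0 * (k * rho1))) * iterDir [:: v0, v1 & nseq 2 v2] S r).
      rewrite normrM [`|rho * _|]normrM -mE.
      have h2 := ler_wpM2l (mulr_ge0 (normr_ge0 rho) (ltW m0)) (hB2 r Kr).
      have : 0 <= `|rho| ^+ 2 * B3 * m by rewrite !mulr_ge0 ?exprn_ge0// ltW.
      by rewrite /D mulrDl; move: h2; rewrite /=; lra.
    by rewrite expr2; ring.
  - have [r Kr ->] := ddE 3%N.
    rewrite (_ : lam * _ = rho ^+ 2 * (lam * rho * (h * rho0 * (k * rho1))) * iterDir [:: v0, v1 & nseq 3 v2] S r).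
      rewrite normrM [`|rho ^+ 2 * _|]normrM -mE normrX.
      have h3 := ler_wpM2l (mulr_ge0 (exprn_ge0 2 (normr_ge0 rho)) (ltW m0)) (hB3 r Kr).
      have : 0 <= `|rho| * B2 * m by rewrite !mulr_ge0// ltW.
      by rewrite /D mulrDl; move: h3; rewrite /=; lra.
    by ring.
have := ler_wpM2r (ltW X1) main.
have -> : 2 * M * (GG * L / m ^+ 2) * (1 + X ^+ 2) =
    2 * M * (GG * L) / c ^+ 2 * (1 + (X ^+ 2)^-1).
  have -> : m ^+ 2 = c ^+ 2 * X ^+ 2 by rewrite /m exprMn real_normK ?num_real.
  by field; rewrite Xn0 lt0r_neq0.
have XV : (X ^+ 2)^-1 <= 1 by rewrite invf_le1 ?ltW// exprn_even_gt0.
have XV1 : 1 + (X ^+ 2)^-1 <= 2 by lra.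
have := ler_wpM2l Q0 XV1; lra.
Qed.

Lemma wave_estimate : exists2 C, 0 <= C & forall lam, lam != 0 ->
  forall g0 g1 g2, bcs1 g0 -> bcs1 g1 -> bcs1 g2 ->
  forall w, w = wave_re lam \/ w = wave_im lam ->
  (\int[mu]_y \int[mu]_x (g0 y * (w (x, y) * (g1 x * g2 (x + y))))) ^+ 2 <=
  C * (`|lam| `^ (- 6^-1)) ^+ 2 * (normsq g0 * (normsq g1 * normsq g2)).
Proof.
have [A A0 hA] := kernel_bound; have [B B0 hB] := wave_bcs.
exists (4 * B ^+ 2 + Num.sqrt (A * trigo.pi)).
  by rewrite addr_ge0 ?sqrtr_ge0// mulr_ge0// exprn_ge0.
move=> lam lam0 g0 g1 g2 b0 b1 b2.
have l0 : 0 < `|lam| by rewrite normr_gt0.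
pose nu := `|lam| `^ 3^-1.
have nu0 : 0 < nu by exact: powR_gt0.
have nu3 : nu ^+ 3 = `|lam|.
  by rewrite -powR_mulrn ?powR_ge0// -powRrM mulVf ?pnatr_eq0// powRr1.
have nuV : (`|lam| `^ (- 6^-1)) ^+ 2 = nu^-1.
  rewrite -powR_mulrn ?powR_ge0// -powRrM -powRN; congr (_ `^ _); lra.
have [_ _ hBl _] := hB lam.
have bre := bcs_wave_re lam; have bim := bcs_wave_im lam.
have kern h k z : `|\int[mu]_x corr2 (wave_re lam) (wave_im lam) h k (x, z - x)| <=
    A / (1 + (nu ^+ 3 * `|h| * k) ^+ 2) by rewrite nu3; exact: hA.
rewrite nuV => w [] ->.
  have := core_estimate bre bim A0 (fun p => (hBl p).1) (fun p => (hBl p).2) nu0 kern b0 b1 b2.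
  by rewrite mulrCA.
(* The sine case is the cosine case for the wave multiplied by -i, which has the same
   correlations. *)
have kern' h k z : `|\int[mu]_x corr2 (wave_im lam) (fun p => - wave_re lam p) h k (x, z - x)| <=
    A / (1 + (nu ^+ 3 * `|h| * k) ^+ 2).
  rewrite (_ : \int[mu]_x _ = \int[mu]_x corr2 (wave_re lam) (wave_im lam) h k (x, z - x))//.
  by apply: eq_Rintegral => x _; rewrite /corr2 /corr_re /corr_im; ring.
have hN p : `|- wave_re lam p| <= B by rewrite normrN; exact: (hBl p).1.
have := core_estimate bim (bcsN bre) A0 (fun p => (hBl p).2) hN nu0 kern' b0 b1 b2.
by rewrite mulrCA.
Qed.

End Kernel.
End Geometry.

(** * Change of variables and square-integrable functions *)

Section ChangeOfVariables.
Context {R : realType}.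
Local Notation mu := (@lebesgue_measure R).
Local Notation mu2 := ((mu \x mu)%E).

Let lin (a b c d : R) (p : R * R) : R * R := (a * p.1 + b * p.2, c * p.1 + d * p.2).

Let measurable_lin a b c d : measurable_fun setT (lin a b c d).
Proof. by rewrite /lin; mfun. Qed.

(** Gaussian elimination with pivot [a] writes the map as shears and one-dimensional scalings by [a]
    and D = det / a, each handled on the line by Tonelli. For a = 0 the general lemma first
    exchanges the two columns. *)
Let ge0_lin_aux (a b c d : R) (G : R * R -> \bar R) : a != 0 -> a * d - b * c != 0 ->
  measurable_fun setT G -> (forall p, 0 <= G p)%E ->
  (\int[mu2]_p G p = `|a * d - b * c|%:E * \int[mu2]_p G (lin a b c d p))%E.
Proof.
move=> a0 det0 mG G0.
have mGl : measurable_fun setT (fun p => G (lin a b c d p)).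
  by apply: measurableT_comp => //; exact: measurable_lin.
have E2 := fubini_tonelli2 (m1 := mu) (m2 := mu) (fun p => G (lin a b c d p)) mGl (fun p => G0 _).
rewrite fubini_tonelli1// [X in (_ = _ * X)%E]E2.
rewrite /fubini_F /fubini_G.
have e1 : (\int[mu]_x \int[mu]_y G (x, y) = \int[mu]_x \int[mu]_y G (x, y + c / a * x)%R)%E.
  apply: eq_integral => x _; rewrite [LHS](integral_shift (c / a * x)) => //.
  by apply: measurableT_comp => //; exact: pair1_measurable.
have mG1 : measurable_fun setT (fun p : R * R => G (p.1, p.2 + c / a * p.1)).
  apply: measurableT_comp => //.
  by apply: (@measurable_fun_pair _ _ _ _ _ _ fst (fun p : R * R => p.2 + c / a * p.1)); mfun.
have E3 := fubini_tonelli (m1 := mu) (m2 := mu) (fun p : R * R => G (p.1, p.2 + c / a * p.1)%R)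
  mG1 (fun p => G0 _).
rewrite [LHS]e1 [LHS]E3 /=.
pose D := d - b * c / a.
have DE : a * d - b * c = a * D by rewrite /D; field.
have D0 : D != 0 by apply: contra_neq det0 => h; rewrite DE h mulr0.
rewrite (ge0_integral_affine 0 D0); last 2 first.
- by have hm := measurable_fun_fubini_tonelli_G (m1 := mu) _ mG1 (fun p => G0 _); exact: hm.
- by move=> y; exact: integral_ge0.
rewrite DE (mulrC a D) normrM EFinM -muleA; congr (_ * _)%E.
have hm := measurable_fun_fubini_tonelli_G (m1 := mu) _ mGl (fun p => G0 _).
rewrite -ge0_integralZl; [|exact: measurableT|exact: hm|by move=> y _; exact: integral_ge0|by rewrite lee_fin].
apply: eq_integral => t _.
rewrite (ge0_integral_affine (b * t) a0).
- congr (_ * _)%E; apply: eq_integral => s _; congr (G (_, _)).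
  by rewrite /D /=; field.
- apply: measurableT_comp => //.
  by apply: (@measurable_fun_pair _ _ _ _ _ _ (fun x : R => x) (fun x : R => D * t + 0 + c / a * x)); mfun.
- by [].
Qed.

Lemma ge0_integral_linear (a b c d : R) (G : R * R -> \bar R) : a * d - b * c != 0 ->
  measurable_fun setT G -> (forall p, 0 <= G p)%E ->
  (\int[mu2]_p G p = `|(a * d - b * c)%R|%:E *
    \int[mu2]_p G (a * p.1 + b * p.2, c * p.1 + d * p.2)%R)%E.
Proof.
move=> det0 mG G0; have [a0|a0] := eqVneq a 0; last exact: ge0_lin_aux.
have b0 : b != 0 by apply: contra_neq det0 => ->; rewrite a0; ring.
have det0' : b * c - a * d != 0 by rewrite -opprB oppr_eq0.
rewrite (ge0_lin_aux b0 det0' mG G0) distrC; congr (_ * _)%E.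
have mGl a' b' c' d' : measurable_fun setT (fun p => G (lin a' b' c' d' p)).
  by apply: measurableT_comp => //; exact: measurable_lin.
have E1 := fubini_tonelli1 (m1 := mu) (m2 := mu) (fun p => G (lin b a d c p)) (mGl b a d c) (fun p => G0 _).
have E2 := fubini_tonelli2 (m1 := mu) (m2 := mu) (fun p => G (lin a b c d p)) (mGl a b c d) (fun p => G0 _).
rewrite [LHS]E1 [RHS]E2.
apply: eq_integral => t _; apply: eq_integral => s _; rewrite /lin /=.
by congr (G (_, _)); rewrite addrC.
Qed.

Lemma Rintegral_linear (a b c d : R) (F : R * R -> R) : a * d - b * c != 0 ->
  measurable_fun setT F ->
  mu2.-integrable setT (EFin \o (fun p => F (a * p.1 + b * p.2, c * p.1 + d * p.2))) ->
  mu2.-integrable setT (EFin \o F) /\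
  \int[mu2]_p F p = `|a * d - b * c| *
    \int[mu2]_p F (a * p.1 + b * p.2, c * p.1 + d * p.2).
Proof.
move=> det0 mF; set T := fun p : R * R => (a * p.1 + b * p.2, c * p.1 + d * p.2) => iF.
have mE : measurable_fun setT (EFin \o F) by exact/measurable_EFinP.
have iF' : mu2.-integrable setT (EFin \o F).
  apply/integrableP; split => //.
  rewrite (ge0_integral_linear det0)//; last by apply: measurableT_comp.
  by case/integrableP: iF => _ h; rewrite lte_mul_pinfty.
split => //; rewrite /Rintegral integralE [in RHS]integralE.
have e1 := ge0_integral_linear det0 (measurable_funepos mE) (fun p => funepos_ge0 _ p).
have e2 := ge0_integral_linear det0 (measurable_funeneg mE) (fun p => funeneg_ge0 _ p).
rewrite e1 e2; pose h p := F (T p).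
have ip : (\int[mu2]_p (EFin \o h)^\+ p)%E \is a fin_num :=
  integrable_fin_num measurableT (integrable_funepos measurableT iF).
have iN : (\int[mu2]_p (EFin \o h)^\- p)%E \is a fin_num :=
  integrable_fin_num measurableT (integrable_funeneg measurableT iF).
rewrite (_ : (\int[mu2]_p (EFin \o F)^\+ (T p) = \int[mu2]_p (EFin \o h)^\+ p)%E); last first.
  by apply: eq_integral => p _; rewrite !funeposE.
rewrite (_ : (\int[mu2]_p (EFin \o F)^\- (T p) = \int[mu2]_p (EFin \o h)^\- p)%E); last first.
  by apply: eq_integral => p _; rewrite !funenegE.
rewrite -(fineK ip) -(fineK iN) -!EFinM -!EFinB /=.
by rewrite -mulrBr; congr (_ * _); rewrite -[LHS]/(fine (_ - _)%:E) EFinB (fineK ip) (fineK iN).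
Qed.

End ChangeOfVariables.

(** * Square-integrable functions and truncation *)

Section SquareIntegrable.
Context {R : realType}.
Local Notation mu := (@lebesgue_measure R).
Local Notation mu2 := ((mu \x mu)%E).
Local Notation bcs1 := (bcs (@Num.norm R R)).
Local Notation bcs2 := (bcs (fun p : R * R => Num.max `|p.1| `|p.2|)).

Definition sqint (g : R -> R) := measurable_fun setT g /\
  mu.-integrable setT (EFin \o (fun x => g x ^+ 2)).

Lemma sqint_scale (g : R -> R) (c : R) : c != 0 -> sqint g ->
  sqint (fun x => g (c * x)) /\ normsq (fun x => g (c * x)) = normsq g / `|c|.
Proof.
move=> c0 [mg ig].
have mg2 : measurable_fun setT (fun x => g x ^+ 2) by mfun.
have e := @ge0_integral_affine R c 0 (fun x => (g x ^+ 2)%:E) c0.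
have {e} e : (\int[mu]_x (g x ^+ 2)%:E = `|c|%:E * \int[mu]_x (g (c * x) ^+ 2)%:E)%E.
  rewrite e; last by move=> x; rewrite lee_fin sqr_ge0.
    by congr (_ * _)%E; apply: eq_integral => x _; rewrite addr0.
  exact/measurable_EFinP.
have fin := integrable_fin_num measurableT ig.
have n0 : 0 < `|c| by rewrite normr_gt0.
have mgc : measurable_fun setT (fun x => g (c * x)) by mfun.
have fin' : (\int[mu]_x (g (c * x) ^+ 2)%:E)%E \is a fin_num.
  rewrite ge0_fin_numE; last by apply: integral_ge0 => x _; rewrite lee_fin sqr_ge0.
  rewrite ltNge leye_eq; apply/negP => /eqP h; move: fin; rewrite /= e h.
  by rewrite gt0_muley// lte_fin.
split; first split => //.
  apply/integrableP; split; first by apply/measurable_EFinP; mfun.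
  rewrite (_ : (\int[mu]_x _ = \int[mu]_x (g (c * x) ^+ 2)%:E)%E).
    by rewrite -ge0_fin_numE//; apply: integral_ge0 => x _; rewrite lee_fin sqr_ge0.
  by apply: eq_integral => x _; rewrite /= ger0_norm// sqr_ge0.
rewrite /normsq /Rintegral e -(fineK fin') -EFinM /= mulrC mulKf ?gt_eqF//.
Qed.

(** Cutting both argument and value lands in the class [bcs], never increases |g|, and equals g x
    for all large n. *)
Definition truncate (n : nat) (g : R -> R) (x : R) : R :=
  if (`|x| <= n%:R) && (`|g x| <= n%:R) then g x else 0.

Lemma bcs_truncate n g : measurable_fun setT g -> bcs1 (truncate n g).
Proof.
move=> mg; apply: (@bcsP _ _ _ _ _ n%:R n%:R).
- apply: measurable_fun_ifT => //.
  apply: measurable_and; apply: measurable_fun_ler => //; apply: measurableT_comp => //.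
- by move=> x; rewrite /truncate; case: ifPn => [/andP[]//|_]; rewrite normr0.
- by move=> x hx; rewrite /truncate leNgt hx.
Qed.

Lemma truncate_le n g x : `|truncate n g x| <= `|g x|.
Proof. by rewrite /truncate; case: ifPn => // _; rewrite normr0. Qed.

Lemma truncate_eq g x : \forall n \near \oo, truncate n g x = g x.
Proof.
exists (Num.trunc (Num.max `|x| `|g x|)).+1 => // n /= hn.
rewrite /truncate.
have : Num.max `|x| `|g x| <= n%:R.
  rewrite (le_trans (ltW (truncnS_gt _)))// ler_nat.
  exact: hn.
by rewrite ge_max => ->.
Qed.

Lemma normsq_truncate n g : sqint g -> normsq (truncate n g) <= normsq g.
Proof.
move=> [mg ig]; have bt := bcs_truncate n mg.
apply: le_Rintegral => //; first exact: bcs_integrable (bcsM bt bt).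
move=> x _; rewrite -(real_normK (num_real (truncate n g x))) -(real_normK (num_real (g x))).
by rewrite ler_sqr ?nnegrE// truncate_le.
Qed.

Lemma integrable_trilinear (w : R * R -> R) (g0 g1 g2 : R -> R) : bcs2 w ->
  sqint g0 -> sqint g1 -> sqint g2 ->
  mu2.-integrable setT (EFin \o (fun p => w p * (g0 p.2 * (g1 p.1 * g2 (p.1 + p.2))))).
Proof.
move=> bw [m0 i0] [m1 i1] [m2 i2].
have [M M0 hM] := bcsE bw.
have mF : measurable_fun setT (fun p => w p * (g0 p.2 * (g1 p.1 * g2 (p.1 + p.2)))) by mfun.
apply/integrable21ltyP; first exact/measurable_EFinP.
pose box (y : R) : R := \1_(`[- M, M]%classic) y.
have box0 y : 0 <= box y by rewrite /box indicE.
have ibox : mu.-integrable setT (EFin \o box).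
  apply: bcs_integrable; apply: (@bcsP _ _ _ _ _ 1 M).
  - by apply: measurable_indic; exact: measurable_itv.
  - by move=> x; rewrite /box indicE; case: (_ \in _); rewrite ?normr0 ?normr1.
  - move=> x hx; rewrite /box indicE memNset//= in_itv/= -ler_norml.
    by apply/negP; rewrite -ltNge.
(* From |ab| <= a^2 + b^2 with a = g0 g1 and b = g2. Integrating in x leaves norms of [g1] and [g2];
   [box], which covers the support of [w] in y, makes the second term integrable in y. *)
pose bnd x y := M * (g0 y ^+ 2 * g1 x ^+ 2 + box y * g2 (x + y) ^+ 2).
have le_bnd x y : `|w (x, y) * (g0 y * (g1 x * g2 (x + y)))| <= bnd x y.
  have [yM|yM] := leP `|y| M; last first.
    rewrite (hM (x, y)).2 ?mul0r ?normr0; last by rewrite /= lt_max yM orbT.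
    by rewrite mulr_ge0// addr_ge0// mulr_ge0// sqr_ge0.
  have -> : bnd x y = M * (g0 y ^+ 2 * g1 x ^+ 2 + g2 (x + y) ^+ 2).
    by rewrite /bnd /box indicE mem_set ?mul1r//= in_itv/= -ler_norml.
  rewrite normrM; apply: ler_pM => //; first exact: (hM _).1.
  rewrite mulrA normrM -exprMn -(real_normK (num_real (g0 y * g1 x))) -(real_normK (num_real (g2 (x + y)))).
  by have := sqr_ge0 (`|g0 y * g1 x| - `|g2 (x + y)|); nra.
have i2s y : mu.-integrable setT (EFin \o (fun x => g2 (x + y) ^+ 2)).
  case/integrableP : i2 => m2' h; apply/integrableP; split; first by apply/measurable_EFinP; mfun.
  apply: le_lt_trans h; rewrite [leRHS](integral_shift y)//.
  by apply: measurableT_comp.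
have i2e y : \int[mu]_x (g2 (x + y) ^+ 2) = normsq g2.
  by rewrite /normsq [RHS](Rintegral_shift y)//; mfun.
have ibnd y : mu.-integrable setT (EFin \o (bnd ^~ y)).
  have := integrableZl measurableT M (integrableD measurableT
     (integrableZl measurableT (g0 y ^+ 2) i1) (integrableZl measurableT (box y) (i2s y))).
  by apply: eq_integrable.
apply: (@le_lt_trans _ _ (\int[mu]_y (M * (g0 y ^+ 2 * normsq g1 + box y * normsq g2))%:E)%E).
  apply: ge0_le_integral => //.
  - by move=> y _; exact: integral_ge0.
  - have mA : measurable_fun setT
        (fun p : R * R => `|(w p * (g0 p.2 * (g1 p.1 * g2 (p.1 + p.2))))%R%:E|%E).
      by apply: measurableT_comp => //; exact/measurable_EFinP.
    by have hm := measurable_fun_fubini_tonelli_G (m1 := mu) _ mA (fun p => abse_ge0 _); exact: hm.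
  - apply/measurable_EFinP; have mb : measurable_fun setT box by apply: measurable_indic; exact: measurable_itv.
    by mfun.
  move=> y _; rewrite (_ : (M * _)%:E = \int[mu]_x (bnd x y)%:E)%E.
    apply: ge0_le_integral => //.
    + by apply: measurableT_comp => //; apply/measurable_EFinP; mfun.
    + by case/integrableP: (ibnd y).
    + by move=> x _; rewrite lee_fin; exact: le_bnd.
  have -> : M * (g0 y ^+ 2 * normsq g1 + box y * normsq g2) = \int[mu]_x bnd x y.
    rewrite /bnd RintegralZl//.
      rewrite RintegralD// ?RintegralZl// ?i2e//.
      - exact: (integrableZl measurableT (g0 y ^+ 2) i1).
      - exact: (integrableZl measurableT (box y) (i2s y)).
    have := integrableD measurableT
     (integrableZl measurableT (g0 y ^+ 2) i1) (integrableZl measurableT (box y) (i2s y)).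
    by apply: eq_integrable.
  by rewrite /Rintegral fineK//; exact: (integrable_fin_num measurableT (ibnd y)).
have := integrableZl measurableT M (integrableD measurableT
     (integrableZl measurableT (normsq g1) i0) (integrableZl measurableT (normsq g2) ibox)).
move=> /(integrable_fin_num measurableT); rewrite ge0_fin_numE.
  apply: le_lt_trans; rewrite le_eqVlt; apply/orP; left; apply/eqP; apply: eq_integral => y _ /=.
  by rewrite -[RHS]/((M * (normsq g1 * g0 y ^+ 2 + normsq g2 * box y))%:E); congr (_%:E); ring.
apply: integral_ge0 => y _ /=.
rewrite -[X in (_ <= X)%E]/((M * (normsq g1 * g0 y ^+ 2 + normsq g2 * box y))%:E) lee_fin.
by rewrite mulr_ge0// addr_ge0// mulr_ge0 ?sqr_ge0 ?normsq_ge0.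
Qed.

(** Dominated convergence along truncations, with the untruncated integrand itself as the dominating
    function. *)
Lemma trilinear_sqint (w : R * R -> R) (C : R) : bcs2 w -> 0 <= C ->
  (forall g0 g1 g2, bcs1 g0 -> bcs1 g1 -> bcs1 g2 ->
    (\int[mu]_y \int[mu]_x (g0 y * (w (x, y) * (g1 x * g2 (x + y))))) ^+ 2 <=
      C * (normsq g0 * (normsq g1 * normsq g2))) ->
  forall g0 g1 g2, sqint g0 -> sqint g1 -> sqint g2 ->
    (\int[mu2]_p (w p * (g0 p.2 * (g1 p.1 * g2 (p.1 + p.2))))) ^+ 2 <=
      C * (normsq g0 * (normsq g1 * normsq g2)).
Proof.
move=> bw C0 est g0 g1 g2 s0 s1 s2.
pose F (h0 h1 h2 : R -> R) (p : R * R) := w p * (h0 p.2 * (h1 p.1 * h2 (p.1 + p.2))).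
pose Fn n := F (truncate n g0) (truncate n g1) (truncate n g2).
have iF : mu2.-integrable setT (EFin \o F g0 g1 g2) := integrable_trilinear bw s0 s1 s2.
set B := C * _.
have b0 n := bcs_truncate n s0.1; have b1 n := bcs_truncate n s1.1; have b2 n := bcs_truncate n s2.1.
have bF n : bcs2 (fun p => truncate n g0 p.2 * (w p * (truncate n g1 p.1 * truncate n g2 (p.1 + p.2)))).
  have [M M0 hM] := bcsE (b0 n).
  apply: (@bcs_mull _ _ _ _ _ (fun p : R * R => truncate n g0 p.2) M).
  - exact: bcsM bw (bcs2_mul_sum (b1 n) (b2 n)).
  - by have := (b0 n).1 => h; mfun.
  - by move=> p; exact: (hM _).1.
have FnE n : Fn n = fun p => truncate n g0 p.2 * (w p * (truncate n g1 p.1 * truncate n g2 (p.1 + p.2))).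
  by apply/funext => p; rewrite /Fn /F; ring.
have FnB n : (\int[mu2]_p Fn n p) ^+ 2 <= B.
  rewrite FnE (Rintegral_bcs2 (bF n)) (Rintegral_bcs2_swap (bF n)) /=.
  apply: le_trans (est _ _ _ (b0 n) (b1 n) (b2 n)) _.
  apply: ler_wpM2l => //.
  by apply: ler_pM; rewrite ?mulr_ge0 ?normsq_ge0 ?normsq_truncate//;
    apply: ler_pM; rewrite ?normsq_ge0 ?normsq_truncate.
have mFn n : measurable_fun setT (EFin \o Fn n).
  by rewrite FnE; apply/measurable_EFinP; exact: (bF n).1.
have mF : measurable_fun setT (EFin \o F g0 g1 g2) by case/integrableP: iF.
have cvF (p : R * R) : (EFin \o Fn n) p @[n --> \oo] --> (EFin \o F g0 g1 g2) p.
  have e : \forall n \near \oo, cst ((EFin \o F g0 g1 g2) p) n = (EFin \o Fn n) p.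
    near=> n; rewrite /= /Fn /F; congr (_ * (_ * (_ * _)))%:E; apply/esym; near: n;
      exact: truncate_eq.
  by apply: cvg_trans (near_eq_cvg e) _; exact: cvg_cst.
have leF (p : R * R) n : (`|(EFin \o Fn n) p| <= `|(EFin \o F g0 g1 g2) p|)%E.
  rewrite /= lee_fin /Fn /F !normrM; apply: ler_wpM2l => //.
  by do 2 (apply: ler_pM; rewrite ?mulr_ge0 ?truncate_le//).
have aeF : {ae mu2, forall p, setT p -> (EFin \o Fn n) p @[n --> \oo] --> (EFin \o F g0 g1 g2) p}.
  by apply: aeW => p _; exact: cvF.
have aeL : {ae mu2, forall p, forall n, setT p -> (`|(EFin \o Fn n) p| <= `|(EFin \o F g0 g1 g2) p|)%E}.
  by apply: aeW => p n _; exact: leF.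
have [_ _ cv] := @dominated_convergence _ _ _ mu2 setT measurableT
   (fun n => EFin \o Fn n) (EFin \o F g0 g1 g2) (fun p => `|(EFin \o F g0 g1 g2) p|%E)
   mFn mF aeF (integrable_abse iF) aeL.
have cv' : (\int[mu2]_p Fn n p) @[n --> \oo] --> \int[mu2]_p F g0 g1 g2 p.
  by rewrite -(fineK (integrable_fin_num measurableT iF)) in cv; exact: (fine_cvg cv).
have cv2 : (\int[mu2]_p Fn n p) ^+ 2 @[n --> \oo] --> (\int[mu2]_p F g0 g1 g2 p) ^+ 2.
  exact: (cvgM cv' cv').
rewrite -(cvg_lim _ cv2)//; apply: limr_le; first by apply/cvg_ex; eexists; exact: cv2.
by near=> n; exact: FnB.
Unshelve. all: by end_near. Qed.

End SquareIntegrable.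

(** * The trilinear form *)

Section RealForm.
Context {R : realType}.
Local Notation mu := (@lebesgue_measure R).
Local Notation mu2 := ((mu \x mu)%E).

Lemma real_form_estimate (v0 v1 v2 w0 w1 pi0 pi1 pi2 : pt R) (rho0 rho1 rho c d : R)
    (S b : pt R -> R) (U K : set (pt R)) :
  w0 = rho0 *: v0 -> w1 = rho1 *: v1 -> w0 - w1 = rho *: v2 ->
  rho0 != 0 -> rho1 != 0 -> rho != 0 ->
  linmap pi0 w0 = 0 -> linmap pi0 w1 = c -> linmap pi1 w0 = d -> linmap pi1 w1 = 0 ->
  linmap pi2 w0 = 1 -> linmap pi2 w1 = 1 -> c != 0 -> d != 0 ->
  smooth_on U S -> smooth_on setT b -> compact K -> Conv K `<=` U ->
  (forall p, b p != 0 -> K p) ->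
  (forall p, Conv K p -> 1 <= `|iterDir [:: v0; v1; v2] S p|) ->
  exists2 C, 0 <= C & forall lam, lam != 0 -> forall g0 g1 g2, sqint g0 -> sqint g1 -> sqint g2 ->
  forall trg, trg = @cos R \/ trg = @sin R ->
  let F p := trg (lam * S p) * b p *
    (g0 (linmap pi0 p) * (g1 (linmap pi1 p) * g2 (linmap pi2 p))) in
  mu2.-integrable setT (EFin \o F) /\
  `|\int[mu2]_p F p| <= C * `|lam| `^ (- 6^-1) *
     Num.sqrt (normsq g0 * (normsq g1 * normsq g2)).
Proof.
move=> w0E w1E w01E r0 r1 r p00 p01 p10 p11 p20 p21 c0 d0 sS sb cK KU bK lowS.
have lin2 (q : pt R) (x y : R) : linmap q (x *: w0 + y *: w1) = x * linmap q w0 + y * linmap q w1.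
  by rewrite /linmap /= /GRing.scale/=; ring.
have [M M0 KM] : exists2 M, 0 <= M &
    forall x y : R, K (x *: w0 + y *: w1) -> `|x| <= M /\ `|y| <= M.
  have cl (q : pt R) p : K p -> {for p, continuous (linmap q : pt R -> R)}.
    by move=> _; apply: cvgD; apply: cvgM; [exact: cvg_cst|exact: cvg_fst|exact: cvg_cst|exact: cvg_snd].
  have [B0 B00 hB0] := compact_le cK (cl pi0); have [B1 B10 hB1] := compact_le cK (cl pi1).
  (* In the basis w0, w1 the first two forms are c y and d x, and both are bounded on [K]; this
     bounds the coordinates. *)
  exists (B1 / `|d| + B0 / `|c|) => [|x y Kxy]; first by rewrite addr_ge0// divr_ge0.
  have := hB0 _ Kxy; have := hB1 _ Kxy; rewrite !lin2 p00 p01 p10 p11 !mulr0 addr0 add0r !normrM.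
  rewrite -!ler_pdivlMr ?normr_gt0// => h1 h2.
  have : 0 <= B1 / `|d| by rewrite divr_ge0.
  have : 0 <= B0 / `|c| by rewrite divr_ge0.
  by lra.
pose det := w0.1 * w1.2 - w1.1 * w0.2.
have det0 : det != 0.
  have e : det * (pi0.1 * pi1.2 - pi0.2 * pi1.1) = - (c * d).
    have -> : det * (pi0.1 * pi1.2 - pi0.2 * pi1.1) =
        linmap pi0 w0 * linmap pi1 w1 - linmap pi0 w1 * linmap pi1 w0.
      by rewrite /det /linmap; ring.
    by rewrite p00 p01 p10 mul0r sub0r.
  apply/negP => /eqP h; move: e; rewrite h mul0r => /eqP.
  by rewrite eq_sym oppr_eq0 mulf_eq0 (negbTE c0) (negbTE d0).
have [C C0 est] := wave_estimate w0E w1E w01E r0 r1 r sS sb cK KU bK lowS M0 KM.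
(* |det| is the Jacobian; 1 / |c| and 1 / |d| come from the squared norms of the rescaled functions
   x -> g0 (c x) and x -> g1 (d x). *)
exists (`|det| * Num.sqrt (C / (`|c| * `|d|))); first by rewrite mulr_ge0// sqrtr_ge0.
move=> lam lam0 g0 g1 g2 s0 s1 s2 trg trgP F.
have [t0 n0] := sqint_scale c0 s0; have [t1 n1] := sqint_scale d0 s1.
pose w (p : R * R) := trg (lam * S (p.1 *: w0 + p.2 *: w1)) * b (p.1 *: w0 + p.2 *: w1).
have wP : w = wave_re w0 w1 S b lam \/ w = wave_im w0 w1 S b lam.
  by case: trgP => e; [left|right]; rewrite /w e.
have bw : bcs (fun p : R * R => Num.max `|p.1| `|p.2|) w.
  case: wP => ->.
    exact: (bcs_wave_re v2 sS sb cK KU bK KM lam).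
  exact: (bcs_wave_im v2 sS sb cK KU bK KM lam).
have ctrg : continuous trg by case: trgP => ->; [exact: continuous_cos|exact: continuous_sin].
have mF : measurable_fun setT F.
  have mw : measurable_fun setT (fun p : R * R => trg (lam * S p) * b p).
    apply: continuous2_measurable; exact: (continuous_wave v2 sS sb cK KU bK ctrg).
  have [m0 _] := s0; have [m1 _] := s1; have [m2 _] := s2.
  have ml (q : pt R) : measurable_fun setT (fun p : R * R => linmap q p).
    by rewrite /linmap; apply: measurable_funD; apply: measurable_funM.
  apply: measurable_funM => //.
  apply: measurable_funM; first exact: (measurableT_comp m0 (ml pi0)).
  by apply: measurable_funM; [exact: (measurableT_comp m1 (ml pi1))|exact: (measurableT_comp m2 (ml pi2))].
have ptE (p : R * R) : (w0.1 * p.1 + w1.1 * p.2, w0.2 * p.1 + w1.2 * p.2) = p.1 *: w0 + p.2 *: w1 :> pt R.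
  by apply: injective_projections; rewrite /= /GRing.scale/=; ring.
have FE (p : R * R) : F (w0.1 * p.1 + w1.1 * p.2, w0.2 * p.1 + w1.2 * p.2) =
    w p * (g0 (c * p.2) * (g1 (d * p.1) * g2 (p.1 + p.2))).
  rewrite ptE /F /w !lin2 p00 p01 p10 p11 p20 p21 !mulr0 !mulr1 addr0 add0r.
  by rewrite (mulrC c) (mulrC d).
have iT := integrable_trilinear bw t0 t1 s2.
have iT' : mu2.-integrable setT (EFin \o (fun p =>
    F (w0.1 * p.1 + w1.1 * p.2, w0.2 * p.1 + w1.2 * p.2))).
  by apply: eq_integrable iT => // p _; rewrite /= FE.
have [iF IE] := Rintegral_linear det0 mF iT'.
split => //; rewrite IE normrM normr_id -/det -!mulrA ler_wpM2l//.
rewrite (_ : \int[mu2]_p _ = \int[mu2]_p (w p * (g0 (c * p.2) * (g1 (d * p.1) * g2 (p.1 + p.2))))); last first.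
  by apply: eq_Rintegral => p _; rewrite FE.
have e2 : 0 <= C * (`|lam| `^ (- 6^-1)) ^+ 2 by rewrite mulr_ge0// exprn_ge0// powR_ge0.
have := trilinear_sqint bw e2 (fun h0 h1 h2 b0 b1 b2 => est lam lam0 h0 h1 h2 b0 b1 b2 w wP) t0 t1 s2.
rewrite n0 n1 => sq.
rewrite -ler_sqr ?nnegrE ?mulr_ge0 ?sqrtr_ge0 ?powR_ge0// real_normK ?num_real//.
apply: le_trans sq _; rewrite !exprMn !sqr_sqrtr; last 2 first.
- by rewrite !mulr_ge0 ?normsq_ge0.
- by rewrite divr_ge0// mulr_ge0.
rewrite le_eqVlt; apply/orP; left; apply/eqP; field.
by rewrite !normr_eq0 c0 d0.
Qed.

End RealForm.

(** * Reduction of complex-valued data to real data *)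

Section ComplexForm.
Context {R : realType}.
Local Notation mu := (@lebesgue_measure R).
Local Notation mu2 := ((mu \x mu)%E).

Lemma Re_le_cabs (z : R[i]) : complex.Re z ^+ 2 <= cabs z ^+ 2.
Proof. by rewrite /cabs sqr_sqrtr ?addr_ge0 ?sqr_ge0// lerDl sqr_ge0. Qed.

Lemma Im_le_cabs (z : R[i]) : complex.Im z ^+ 2 <= cabs z ^+ 2.
Proof. by rewrite /cabs sqr_sqrtr ?addr_ge0 ?sqr_ge0// lerDr sqr_ge0. Qed.

Lemma sqint_part (f : R -> R[i]) (g : R -> R) : L2 f -> measurable_fun setT g ->
  (forall t, g t ^+ 2 <= cabs (f t) ^+ 2) ->
  sqint g /\ Num.sqrt (normsq g) <= L2norm f.
Proof.
move=> [mr [mi fin]] mg gf.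
have mc : measurable_fun setT (fun t => cabs (f t) ^+ 2).
  rewrite (_ : (fun t => _) = fun t => complex.Re (f t) ^+ 2 + complex.Im (f t) ^+ 2).
    by apply: measurable_funD; apply: measurable_funX.
  by apply/funext => t; rewrite /cabs sqr_sqrtr// addr_ge0 ?sqr_ge0.
have ic : mu.-integrable setT (EFin \o (fun t => cabs (f t) ^+ 2)).
  apply/integrableP; split; first exact/measurable_EFinP.
  apply: le_lt_trans fin; rewrite le_eqVlt; apply/orP; left; apply/eqP.
  by apply: eq_integral => t _; rewrite /= ger0_norm ?sqr_ge0.
have ig : mu.-integrable setT (EFin \o (fun t => g t ^+ 2)).
  apply: le_integrable ic => //; first by apply/measurable_EFinP; mfun.
  by move=> t _; rewrite /= lee_fin !ger0_norm ?sqr_ge0.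
split => //; rewrite /L2norm ler_wsqrtr//; apply: le_Rintegral => // t _; exact: gf.
Qed.

Lemma sqint_Re (f : R -> R[i]) : L2 f -> sqint (fun t => complex.Re (f t)) /\
  Num.sqrt (normsq (fun t => complex.Re (f t))) <= L2norm f.
Proof. by move=> Lf; apply: sqint_part => //; [exact: Lf.1|move=> t; exact: Re_le_cabs]. Qed.

Lemma sqint_Im (f : R -> R[i]) : L2 f -> sqint (fun t => complex.Im (f t)) /\
  Num.sqrt (normsq (fun t => complex.Im (f t))) <= L2norm f.
Proof. by move=> Lf; apply: sqint_part => //; [exact: Lf.2.1|move=> t; exact: Im_le_cabs]. Qed.

(** Integrability is carried along with the bounds so that the integral of a sum can be split. *)
Definition cbound (F : pt R -> R[i]) (B : R) :=
  [/\ mu2.-integrable setT (EFin \o (fun p => complex.Re (F p))),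
      mu2.-integrable setT (EFin \o (fun p => complex.Im (F p))),
      `|\int[mu2]_p complex.Re (F p)| <= B & `|\int[mu2]_p complex.Im (F p)| <= B].

Definition ofreal (x : R) : R[i] := (x +i* 0)%C.

(** Each part of X f is a sum or difference of one part from either hypothesis, which doubles the
    bound. *)
Lemma cbound_split (X f : pt R -> R[i]) (B : R) :
  cbound (fun p => X p * ofreal (complex.Re (f p))) B ->
  cbound (fun p => X p * ofreal (complex.Im (f p))) B ->
  cbound (fun p => X p * f p) (2 * B).
Proof.
move=> [i1 i2 b1 b2] [j1 j2 c1 c2].
have reE p : complex.Re (X p * f p) = complex.Re (X p * ofreal (complex.Re (f p))) -
    complex.Im (X p * ofreal (complex.Im (f p))).
  by case: (X p) (f p) => [x y] [z t]; rewrite /ofreal /=; ring.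
have imE p : complex.Im (X p * f p) = complex.Im (X p * ofreal (complex.Re (f p))) +
    complex.Re (X p * ofreal (complex.Im (f p))).
  by case: (X p) (f p) => [x y] [z t]; rewrite /ofreal /=; ring.
split.
- by apply: eq_integrable (integrableB measurableT i1 j2) => // p _; rewrite /= reE.
- by apply: eq_integrable (integrableD measurableT i2 j1) => // p _; rewrite /= imE.
- under eq_Rintegral do rewrite reE.
  by rewrite RintegralB// (le_trans (ler_normB _ _))//; lra.
- under eq_Rintegral do rewrite imE.
  by rewrite RintegralD// (le_trans (ler_normD _ _))//; lra.
Qed.

Lemma cbound_eq (F G : pt R -> R[i]) (B : R) : F =1 G -> cbound F B -> cbound G B.
Proof. by move=> /funext ->. Qed.

Lemma cabs_cintegral2_le (F : pt R -> R[i]) (B : R) : cbound F B ->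
  cabs (cintegral2 F) <= 2 * B.
Proof.
move=> [_ _ b1 b2]; rewrite /cintegral2 /cabs /=.
set x := Rintegral _ _ _ in b1 *; set y := Rintegral _ _ _ in b2 *.
have B0 : 0 <= B by rewrite (le_trans _ b1).
rewrite -[leRHS]ger0_norm ?mulr_ge0// -sqrtr_sqr ler_wsqrtr//.
rewrite -(real_normK (num_real x)) -(real_normK (num_real y)).
have hx : `|x| ^+ 2 <= B ^+ 2 by rewrite ler_sqr ?nnegrE.
have hy : `|y| ^+ 2 <= B ^+ 2 by rewrite ler_sqr ?nnegrE.
rewrite exprMn; have := sqr_ge0 B; lra.
Qed.

End ComplexForm.

(** * Linear forms and their kernels in the plane *)

Section PlaneGeometry.
Context {R : realType}.
Implicit Types p q u v : pt R.

Lemma linmapZ q (k : R) v : linmap q (k *: v) = k * linmap q v.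
Proof. by rewrite /linmap /= /GRing.scale/=; ring. Qed.

Lemma linmapB q u v : linmap q (u - v) = linmap q u - linmap q v.
Proof. by rewrite /linmap /=; ring. Qed.

Lemma linmap_neq0 p q v : p.1 * q.2 - p.2 * q.1 != 0 -> v.1 ^+ 2 + v.2 ^+ 2 = 1 ->
  linmap p v = 0 -> linmap q v != 0.
Proof.
move=> det0 v1 pv; apply/negP => /eqP qv.
have e1 : v.1 * (p.1 * q.2 - p.2 * q.1) = 0.
  have -> : v.1 * (p.1 * q.2 - p.2 * q.1) = q.2 * linmap p v - p.2 * linmap q v.
    by rewrite /linmap; ring.
  by rewrite pv qv !mulr0 subrr.
have e2 : v.2 * (p.1 * q.2 - p.2 * q.1) = 0.
  have -> : v.2 * (p.1 * q.2 - p.2 * q.1) = p.1 * linmap q v - q.1 * linmap p v.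
    by rewrite /linmap; ring.
  by rewrite pv qv !mulr0 subrr.
move/eqP: e1; move/eqP: e2; rewrite !mulf_eq0 (negbTE det0) !orbF => /eqP h2 /eqP h1.
by move: v1; rewrite h1 h2 !expr0n /= addr0 => /eqP; rewrite eq_sym oner_eq0.
Qed.

(** [p] only witnesses that [q] is nonzero, so its kernel is a line; on it the coefficient with
    respect to a unit vector is the scalar product. *)
Lemma parallel_unit p q u v : p.1 * q.2 - p.2 * q.1 != 0 -> v.1 ^+ 2 + v.2 ^+ 2 = 1 ->
  linmap q u = 0 -> linmap q v = 0 -> u = (u.1 * v.1 + u.2 * v.2) *: v.
Proof.
move=> det0 v1 qu qv.
have /eqP X0 : (p.1 * q.2 - p.2 * q.1) * (u.1 * v.2 - u.2 * v.1) = 0.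
  have -> : (p.1 * q.2 - p.2 * q.1) * (u.1 * v.2 - u.2 * v.1) =
      p.1 * (u.1 * linmap q v - v.1 * linmap q u) + p.2 * (u.2 * linmap q v - v.2 * linmap q u).
    by rewrite /linmap; ring.
  by rewrite qu qv !mulr0 !subr0 !mulr0 addr0.
move: X0; rewrite mulf_eq0 (negbTE det0) /= subr_eq0 => /eqP X.
apply: injective_projections; rewrite /= /GRing.scale/=.
  have -> : (u.1 * v.1 + u.2 * v.2) * v.1 = u.1 * v.1 ^+ 2 + v.2 * (u.2 * v.1) by ring.
  rewrite -X; have -> : u.1 * v.1 ^+ 2 + v.2 * (u.1 * v.2) = u.1 * (v.1 ^+ 2 + v.2 ^+ 2) by ring.
  by rewrite v1 mulr1.
have -> : (u.1 * v.1 + u.2 * v.2) * v.2 = u.2 * v.2 ^+ 2 + v.1 * (u.1 * v.2) by ring.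
rewrite X; have -> : u.2 * v.2 ^+ 2 + v.1 * (u.2 * v.1) = u.2 * (v.1 ^+ 2 + v.2 ^+ 2) by ring.
by rewrite v1 mulr1.
Qed.

End PlaneGeometry.

Theorem theorem1p3 (R : realType) (pi : 'I_3 -> pt R) (v : 'I_3 -> pt R)
    (a : pt R -> R[i]) (S : pt R -> R) (U : set (pt R)) :
  (* pi_1, pi_2, pi_3 pairwise linearly independent linear maps R^2 -> R *)
  (forall i j : 'I_3, i != j -> (pi i).1 * (pi j).2 - (pi i).2 * (pi j).1 != 0) ->
  (* v_j Euclidean unit vectors with pi_j(v_j) = 0 *)
  (forall j : 'I_3, (v j).1 ^+ 2 + (v j).2 ^+ 2 = 1 /\ linmap (pi j) (v j) = 0) ->
  (* a in C_c^infty, supported in a bounded neighbourhood of 0 *)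
  Cc_infty a ->
  (exists V : set (pt R), nbhs (0 : pt R) V /\ bounded_set V /\ supp a `<=` V) ->
  (* S smooth real-valued on an (open) neighbourhood U of Conv(supp a) *)
  Conv (supp a) `<=` U -> smooth_on U S ->
  (forall p, Conv (supp a) p -> 1 <= `| iterDir (map v (enum 'I_3)) S p |) ->
  exists C : R, forall lam : R, lam != 0 ->
    forall f : 'I_3 -> R -> R[i], (forall j, L2 (f j)) ->
      cabs (Lambda lam S a pi f) <=
        C * (`|lam| `^ (- (6^-1))) * \prod_(j < 3) L2norm (f j).
Proof.
move=> indep vP [sr [si cK]] _ KU sS low.
pose i0 : 'I_3 := ord0; pose i1 : 'I_3 := lift ord0 ord0.
pose i2 : 'I_3 := lift ord0 (lift ord0 ord0).
have enumE : enum 'I_3 = [:: i0; i1; i2].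
  by apply: (inj_map val_inj); rewrite val_enum_ord.
rewrite enumE /= in low.
have [u0 z0] := vP i0; have [u1 z1] := vP i1; have [u2 z2] := vP i2.
have k20 : linmap (pi i2) (v i0) != 0 := linmap_neq0 (indep i0 i2 isT) u0 z0.
have k21 : linmap (pi i2) (v i1) != 0 := linmap_neq0 (indep i1 i2 isT) u1 z1.
have k10 : linmap (pi i1) (v i0) != 0 := linmap_neq0 (indep i0 i1 isT) u0 z0.
have k01 : linmap (pi i0) (v i1) != 0 := linmap_neq0 (indep i1 i0 isT) u1 z1.
pose w0 : pt R := (linmap (pi i2) (v i0))^-1 *: v i0.
pose w1 : pt R := (linmap (pi i2) (v i1))^-1 *: v i1.
have p20 : linmap (pi i2) w0 = 1 by rewrite linmapZ mulVf.
have p21 : linmap (pi i2) w1 = 1 by rewrite linmapZ mulVf.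
have p00 : linmap (pi i0) w0 = 0 by rewrite linmapZ z0 mulr0.
have p11 : linmap (pi i1) w1 = 0 by rewrite linmapZ z1 mulr0.
have c0 : linmap (pi i0) w1 != 0 by rewrite linmapZ mulf_neq0 ?invr_neq0.
have d0 : linmap (pi i1) w0 != 0 by rewrite linmapZ mulf_neq0 ?invr_neq0.
have w2 : linmap (pi i2) (w0 - w1) = 0 by rewrite linmapB p20 p21 subrr.
pose rho := (w0 - w1).1 * (v i2).1 + (w0 - w1).2 * (v i2).2.
have w01 : w0 - w1 = rho *: v i2 := parallel_unit (indep i0 i2 isT) u2 w2 z2.
(* Otherwise w0 = w1, a vector annihilated by the first form, contrary to [c0]. *)
have r0 : rho != 0.
  apply/negP => /eqP h; move: w01; rewrite h scale0r => /eqP; rewrite subr_eq0 => /eqP e.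
  by move: c0; rewrite -e p00 eqxx.
have aK (b : pt R -> R) : (forall p, a p = 0 -> b p = 0) -> forall p, b p != 0 -> supp a p.
  move=> h p bp; apply: subset_closure; rewrite /=.
  by apply: contra_neq bp; exact: h.
have est b (sb : smooth_on setT b) (hb : forall p, a p = 0 -> b p = 0) :=
  real_form_estimate (erefl w0) (erefl w1) w01 (invr_neq0 k20) (invr_neq0 k21) r0
    p00 erefl erefl p11 p20 p21 c0 d0 sS sb cK KU (aK b hb) low.
have [C1 C10 E1] := est _ sr (fun p (h : a p = 0) => congr1 (@complex.Re R) h).
have [C2 C20 E2] := est _ si (fun p (h : a p = 0) => congr1 (@complex.Im R) h).
(* Four splittings, for f_1, f_2, f_3 and [a], and the passage from parts to the modulus each cost a
   factor 2. *)
exists (32 * (C1 + C2)) => lam lam0 f L2f.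
pose B := (C1 + C2) * (`|lam| `^ (- (6^-1))) *
  (L2norm (f i0) * (L2norm (f i1) * L2norm (f i2))).
have e0 : 0 <= `|lam| `^ (- (6^-1)) by exact: powR_ge0.
have L0 j : 0 <= L2norm (f j) by exact: sqrtr_ge0.
pose part (h : R -> R[i]) (g : R -> R) :=
  g = (fun t => complex.Re (h t)) \/ g = (fun t => complex.Im (h t)).
pose apart (b : pt R -> R) :=
  b = (fun p => complex.Re (a p)) \/ b = (fun p => complex.Im (a p)).
have partP j g : part (f j) g -> sqint g /\ Num.sqrt (normsq g) <= L2norm (f j).
  by case=> ->; [exact: sqint_Re|exact: sqint_Im].
pose e p := cis (lam * S p).
pose F j p := f j (linmap (pi j) p).
have base (b : pt R -> R) g0 g1 g2 :
    apart b -> part (f i0) g0 -> part (f i1) g1 -> part (f i2) g2 ->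
    cbound (fun p => e p * ofreal (b p) * ofreal (g0 (linmap (pi i0) p)) *
      ofreal (g1 (linmap (pi i1) p)) * ofreal (g2 (linmap (pi i2) p))) B.
  move=> hb /partP[s0 n0] /partP[s1 n1] /partP[s2 n2].
  have key trg : trg = @cos R \/ trg = @sin R ->
      let G p := trg (lam * S p) * b p * (g0 (linmap (pi i0) p) *
        (g1 (linmap (pi i1) p) * g2 (linmap (pi i2) p))) in
      (lebesgue_measure \x lebesgue_measure)%E.-integrable setT (EFin \o G) /\ `|\int[(lebesgue_measure \x lebesgue_measure)%E]_p G p| <= B.
    move=> htrg G.
    have le_sqrt : Num.sqrt (normsq g0 * (normsq g1 * normsq g2)) <=
        L2norm (f i0) * (L2norm (f i1) * L2norm (f i2)).
      rewrite !sqrtrM ?normsq_ge0//.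
      by apply: ler_pM; rewrite ?mulr_ge0 ?sqrtr_ge0//; apply: ler_pM; rewrite ?sqrtr_ge0.
    have fin (C : R) : 0 <= C -> C <= C1 + C2 ->
        C * `|lam| `^ (- 6^-1) * Num.sqrt (normsq g0 * (normsq g1 * normsq g2)) <= B.
      move=> Cp Cle; apply: ler_pM; rewrite ?mulr_ge0 ?sqrtr_ge0//.
      by rewrite ler_wpM2r.
    case: hb => eb.
      have [iG bG] := E1 lam lam0 g0 g1 g2 s0 s1 s2 trg htrg.
      split; first by rewrite /G eb.
      by rewrite /G eb; apply: le_trans bG _; apply: fin => //; rewrite lerDl.
    have [iG bG] := E2 lam lam0 g0 g1 g2 s0 s1 s2 trg htrg.
    split; first by rewrite /G eb.
    by rewrite /G eb; apply: le_trans bG _; apply: fin => //; rewrite lerDr.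
  have [ic bc] := key _ (or_introl erefl); have [is_ bs] := key _ (or_intror erefl).
  have reE p : complex.Re (e p * ofreal (b p) * ofreal (g0 (linmap (pi i0) p)) *
      ofreal (g1 (linmap (pi i1) p)) * ofreal (g2 (linmap (pi i2) p))) =
      cos (lam * S p) * b p * (g0 (linmap (pi i0) p) *
        (g1 (linmap (pi i1) p) * g2 (linmap (pi i2) p))).
    by rewrite /e /cis /ofreal /=; ring.
  have imE p : complex.Im (e p * ofreal (b p) * ofreal (g0 (linmap (pi i0) p)) *
      ofreal (g1 (linmap (pi i1) p)) * ofreal (g2 (linmap (pi i2) p))) =
      sin (lam * S p) * b p * (g0 (linmap (pi i0) p) *
        (g1 (linmap (pi i1) p) * g2 (linmap (pi i2) p))).
    by rewrite /e /cis /ofreal /=; ring.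
  split.
  - by apply: eq_integrable ic => // p _; congr EFin; exact: esym (reE p).
  - by apply: eq_integrable is_ => // p _; congr EFin; exact: esym (imE p).
  - by under eq_Rintegral do rewrite reE.
  - by under eq_Rintegral do rewrite imE.
have pRe j : part (f j) (fun t => complex.Re (f j t)) by left.
have pIm j : part (f j) (fun t => complex.Im (f j t)) by right.
have step1 b g0 g1 (hb : apart b) (h0 : part (f i0) g0) (h1 : part (f i1) g1) : cbound (fun p => e p * ofreal (b p) * ofreal (g0 (linmap (pi i0) p)) *
      ofreal (g1 (linmap (pi i1) p)) * F i2 p) (2 * B).
  by apply: cbound_split; [exact: (base b g0 g1 _ hb h0 h1 (pRe i2))|exact: (base b g0 g1 _ hb h0 h1 (pIm i2))].
have step2 b g0 (hb : apart b) (h0 : part (f i0) g0) : cbound (fun p => e p * ofreal (b p) * ofreal (g0 (linmap (pi i0) p)) *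
      F i1 p * F i2 p) (2 * (2 * B)).
  (* [cbound_split] acts on the last factor, so the factor to be split is moved to the end each
     time. *)
  apply: (@cbound_eq _ (fun p => e p * ofreal (b p) * ofreal (g0 (linmap (pi i0) p)) * F i2 p * F i1 p)).
    by move=> p; rewrite mulrAC.
  apply: cbound_split.
    by apply: cbound_eq (step1 b g0 _ hb h0 (pRe i1)) => p; rewrite mulrAC.
  by apply: cbound_eq (step1 b g0 _ hb h0 (pIm i1)) => p; rewrite mulrAC.
have step3 b (hb : apart b) : cbound (fun p => e p * ofreal (b p) * F i0 p * F i1 p * F i2 p) (2 * (2 * (2 * B))).
  apply: (@cbound_eq _ (fun p => e p * ofreal (b p) * F i1 p * F i2 p * F i0 p)).
    by move=> p; ring.
  apply: cbound_split.
    by apply: cbound_eq (step2 b _ hb (pRe i0)) => p; rewrite /F; ring.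
  by apply: cbound_eq (step2 b _ hb (pIm i0)) => p; rewrite /F; ring.
have step4 : cbound (fun p => e p * F i0 p * F i1 p * F i2 p * a p) (2 * (2 * (2 * (2 * B)))).
  apply: cbound_split.
    by apply: cbound_eq (step3 _ (or_introl erefl)) => p; ring.
  by apply: cbound_eq (step3 _ (or_intror erefl)) => p; ring.
have -> : Lambda lam S a pi f = cintegral2 (fun p => e p * F i0 p * F i1 p * F i2 p * a p).
  rewrite /Lambda; congr cintegral2; apply/funext => p.
  by rewrite !big_ord_recl big_ord0 /F /e -/i0 -/i1 -/i2; ring.
apply: le_trans (cabs_cintegral2_le step4) _.
rewrite !big_ord_recl big_ord0 -/i0 -/i1 -/i2 mulr1 /B; lra.
Qed.
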